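(* Let $X$ be a random vector in a separable Hilbert space $H$ and let $(X_1,\dots,X_n)$ be a sample made of $n$ independent copies of $X$. Let $\sigma>0$, $k\ge2$, $n\ge2k$. For $c\in H^k$ put $$\mathcal{R}_2(c)=2\sigma^2\,\mathbb{P}_X\Bigl[1-\exp\Bigl(-\frac1{2\sigma^2}\min_{1\le j\le k}\lVert X-c_j\rVert^2\Bigr)\Bigr],\qquad \overline{\mathcal{R}}_2(c)=2\sigma^2\,\overline{\mathbb{P}}_X\Bigl[1-\exp\Bigl(-\frac1{2\sigma^2}\min_{1\le j\le k}\lVert X-c_j\rVert^2\Bigr)\Bigr].$$ (1) For any $\delta\in(0,1)$, with probability at least $1-\delta$, for any $c\in H^k$, $$\mathcal{R}_2(c)\le\overline{\mathcal{R}}_2(c)+2\sigma^2\Biggl(\frac{\log(n/k)}{\log2}\sqrt{\frac{8k\log k}{n}}+2\sqrt{\frac{k\log k}{n}}+\sqrt{\frac{(\sqrt2+1)k(3+2\log k)}{n}}+\sqrt{\frac{\log(\delta^{-1})}{2n}}\Biggr).$$ (2) For any non-random $c^*\in H^k$ and any $\delta\in(0,1)$, with probability at least $1-\delta$, for any $c\in H^k$, $$\mathcal{R}_2(c)-\mathcal{R}_2(c^* )\le\overline{\mathcal{R}}_2(c)-\overline{\mathcal{R}}_2(c^* )+2\sigma^2\Biggl(\frac{\log(n/k)}{\log2}\sqrt{\frac{8k\log k}{n}}+2\sqrt{\frac{k\log k}{n}}+\sqrt{\frac{(\sqrt2+1)k(3+2\log k)}{n}}+\sqrt{\frac{2\log(\delta^{-1})}{n}}\Biggr).$$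 (3) Consequently, for any $\epsilon\ge0$, if $\widehat c\in H^k$ (depending on the sample) satisfies $\overline{\mathcal{R}}_2(\widehat c)\le\inf_{c\in H^k}\overline{\mathcal{R}}_2(c)+\epsilon$, then for any $\delta\in(0,1)$, with probability at least $1-\delta$, $$\mathcal{R}_2(\widehat c)\le\inf_{c\in H^k}\mathcal{R}_2(c)+2\sigma^2\Biggl(\frac{\log(n/k)}{\log2}\sqrt{\frac{8k\log k}{n}}+2\sqrt{\frac{k\log k}{n}}+\sqrt{\frac{(\sqrt2+1)k(3+2\log k)}{n}}+\sqrt{\frac{2\log(\delta^{-1})}{n}}\Biggr)+\epsilon.$$ (4) In the same way, in expectation, $$\mathbb{P}_{X_1,\dots,X_n}\bigl(\mathcal{R}_2(\widehat c)\bigr)\le\inf_{c\in H^k}\mathcal{R}_2(c)+2\sigma^2\Biggl(\frac{\log(n/k)}{\log2}\sqrt{\frac{8k\log k}{n}}+2\sqrt{\frac{k\log k}{n}}+\sqrt{\frac{(\sqrt2+1)k(3+2\log k)}{n}}\Biggr)+\epsilon.$$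
   Context: $\mathbb{P}_X(f(X))$ denotes expectation under the law $\mathbb{P}_X$ of $X$; $\overline{\mathbb{P}}_X=\frac1n\sum_{i=1}^n\delta_{X_i}$ is the empirical measure, so $\overline{\mathbb{P}}_X(f(X))=\frac1n\sum_{i=1}^nf(X_i)$; $\mathbb{P}_{X_1,\dots,X_n}$ is the expectation with respect to the sample. *)

(* Defs.v *)
From HB Require Import structures.
From mathcomp Require Import all_boot all_order all_algebra.
From mathcomp Require Import all_classical all_reals all_analysis.

Set Implicit Arguments.
Unset Strict Implicit.
Unset Printing Implicit Defensive.
Import Order.TTheory GRing.Theory Num.Theory.
Import numFieldNormedType.Exports.
Local Open Scope classical_set_scope.
Local Open Scope ring_scope.

(* A real Hilbert space is a complete normed module together with a symmetric
   positive definite bilinear form that induces its norm. *)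
Definition induces_norm (R : realType) (H : completeNormedModType R)
    (dotp : {dot H for @idfun R}) : Prop :=
  forall x : H, `|x| ^+ 2 = dotp x x.

Definition separable (T : topologicalType) : Prop :=
  exists S : set T, countable S /\ dense S.

(* H equipped with its Borel sigma-algebra; convertible to H itself. *)
Notation borel H := (g_sigma_algebraType (@open H)).

Definition mutually_independent (R : realType) (d d' : measure_display)
    (T : measurableType d) (P : probability T R) (E : measurableType d')
    (n : nat) (X : 'I_n -> {RV P >-> E}) : Prop :=
  forall B : 'I_n -> set E, (forall i, measurable (B i)) ->
    P (\bigcap_i (X i @^-1` B i)) = (\prod_(i < n) P (X i @^-1` B i))%E.

Definition identically_distributed (R : realType) (d d0 d' : measure_display)
    (T : measurableType d) (P : probability T R)
    (T0 : measurableType d0) (P0 : probability T0 R) (E : measurableType d')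
    (Y : {RV P >-> E}) (X : {RV P0 >-> E}) : Prop :=
  forall B : set E, measurable B -> distribution P Y B = distribution P0 X B.

(* "E holds with probability at least p". When E is measurable this is just
   p <= P E; the inner event only matters for estimators that are not assumed
   to be measurable. *)
Definition with_prob_ge (R : realType) (d : measure_display)
    (T : measurableType d) (P : probability T R) (p : R) (E : set T) : Prop :=
  exists A : set T, [/\ measurable A, A `<=` E & (p%:E <= P A)%E].

(* The infimum of a finite family, hence its minimum as soon as 0 < k
   (see min_sqdistP). *)
Definition min_sqdist (R : realType) (H : completeNormedModType R) (k : nat)
    (c : 'I_k -> H) (x : H) : R :=
  inf [set `|x - c j| ^+ 2 | j in [set: 'I_k]].

Lemma min_sqdistP (R : realType) (H : completeNormedModType R) (k : nat)
    (c : 'I_k -> H) (x : H) : (0 < k)%N ->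
  (exists j, min_sqdist c x = `|x - c j| ^+ 2) /\
  (forall j, min_sqdist c x <= `|x - c j| ^+ 2).
Proof.
move=> k0; set f := fun j => `|x - c j| ^+ 2.
have lb : has_lbound [set f j | j in [set: 'I_k]].
  by exists 0 => _ [j _ <-]; rewrite sqr_ge0.
have le_f j : min_sqdist c x <= f j by apply: (ge_inf lb); exists j.
split=> //; case: (arg_minP f (isT : xpredT (Ordinal k0))) => j _ fj.
exists j; apply/eqP; rewrite eq_le le_f /=.
by apply: lb_le_inf; [exists (f j), j | move=> _ [i _ <-]; exact: fj].
Qed.

Definition robust_loss (R : realType) (H : completeNormedModType R)
    (sigma : R) (k : nat) (c : 'I_k -> H) (x : H) : R :=
  1 - expR (- ((2 * sigma ^+ 2)^-1 * min_sqdist c x)).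

Definition risk2 (R : realType) (H : completeNormedModType R)
    (mu : probability (borel H) R) (sigma : R) (k : nat) (c : 'I_k -> H) : R :=
  2 * sigma ^+ 2 * (\int[mu]_x robust_loss sigma c x).

Definition emp_risk2 (R : realType) (H : completeNormedModType R)
    (sigma : R) (n : nat) (xs : 'I_n -> H) (k : nat) (c : 'I_k -> H) : R :=
  2 * sigma ^+ 2 * (n%:R^-1 * \sum_(i < n) robust_loss sigma c (xs i)).

Definition chaining_bound (R : realType) (n k : nat) : R :=
  ln (n%:R / k%:R) / ln 2 * Num.sqrt (8 * k%:R * ln k%:R / n%:R)
  + 2 * Num.sqrt (k%:R * ln k%:R / n%:R)
  + Num.sqrt ((Num.sqrt 2 + 1) * k%:R * (3 + 2 * ln k%:R) / n%:R).

(* Main.v *)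
Require Import Defs.
From HB Require Import structures.
From mathcomp Require Import all_boot all_order all_algebra.
From mathcomp Require Import all_classical all_reals all_analysis.
From mathcomp Require Import measurable_realfun.
From mathcomp Require Import ring lra.

Set Implicit Arguments.
Unset Strict Implicit.
Unset Printing Implicit Defensive.
Import Order.TTheory GRing.Theory Num.Theory.
Import numFieldNormedType.Exports.
Local Open Scope classical_set_scope.
Local Open Scope ring_scope.

(** One minus the robust loss of a codebook [c] at [x] is the largest of the
    values at [(x, c_j)] of the Gaussian kernel, that is, of the inner products
    of [x] and [c_j] in the feature space of the kernel, where all points are
    unit vectors.  Everything reduces to the deviations
    [excess c] = (empirical mean - mean) of these maxima of [k] linear forms,
    uniformly over [c].

    Concentration.  One observation changes the supremum of the deviations by
    at most [1 / n] (by [2 / n] when the deviation at a fixed codebook is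
    subtracted), so the bounded difference inequality [mcdiarmid] reduces the
    high probability statements to a bound on the expectation.

    Expectation.  The parameter [m], made of [k] vectors of the unit ball, is
    replaced by the average of [2 ^ p] independent random sign vectors of mean
    [m].  This random parameter has a law whose chi-square divergence from the
    law of fair signs, which depends neither on [m] nor on the sample, is at
    most [exp (2 ^ p * k)]; the PAC-Bayesian inequality [pac_bayes_dev] then
    controls, uniformly in [m], the expectation over the signs of the deviation
    of any bounded function of them.  Between level [p + 1] and level [p] this
    function is the effect of a centred noise of variance [2 ^ - p] on a maximum
    of [k] numbers ([crest_smoothing]), of order [sqrt (ln k / 2 ^ p)]: the
    entropy and the square of the range compensate and each of the
    [log2 (n / k)] levels costs at most [sqrt (8 k ln k / n)]
    ([chaining_step]).  At the finest level, the bias of the smoothing is of the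
    order of [sqrt (k ln k / n)] ([chaining_bias]); at the coarsest one, the
    function takes its values in the unit interval ([chaining_base]).  The
    maximum is clipped to this interval, which does not change the criterion.
    The coarse cloud is drawn from the fine one by [splice], which picks each
    sign in one of the two halves of the fine cloud; [splice_law] says that this
    produces the right law.

    Reduction to finite sums.  All of this is done for a law with finite
    support and finitely many codebooks, with [Esample] as expectation: the
    Gaussian kernel is then approximated by inner products in a Euclidean space
    ([gauss_features]) and no measure theory is needed.  A finite measurable
    partition on whose cells finitely many criteria are almost constant transfers
    the result to the original sample ([finite_model]); separability and the
    uniform continuity of the criterion in [c] extend it from finite families of
    codebooks to all of them ([uniform_deviation], [mean_deviation]). *)

(** * Hoeffding's lemma *)

Lemma ndecr_from0 (R : realType) (f df : R -> R) :
  (forall x : R, is_derive x 1 f (df x)) -> (forall x, 0 <= x -> 0 <= df x) ->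
  forall x, 0 <= x -> f 0 <= f x.
Proof.
move=> fD df0 x x0.
have fc : {within `[0, x], continuous f}.
  by apply: derivable_within_continuous => y _; have [] := fD y.
have [c cx fx] := MVT_segment x0 (fun y _ => fD y) fc.
rewrite -subr_ge0 fx mulr_ge0 ?subr_ge0 // df0 //.
by move: cx; rewrite in_itv /= => /andP[].
Qed.

(** The cumulant generating function of a Bernoulli variable has second
    derivative at most 1/4, as the variance of a Bernoulli variable; [chi] below
    is the derivative of the difference of the two sides. *)
Lemma two_point_mgf_pos (R : realType) (q u : R) : 0 <= q <= 1 -> 0 <= u ->
  ln (1 - q + q * expR u) <= u ^+ 2 / 8 + q * u.
Proof.
move=> /andP[q0 q1] u0.
pose D (x : R) := 1 - q + q * expR x.
have D0 x : 0 < D x.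
  rewrite /D; have := expR_gt0 x; have [->|qn0] := eqVneq q 0; first by lra.
  move=> e0; have : 0 < q * expR x by rewrite mulr_gt0 // lt_def qn0.
  lra.
have DD (x : R) : is_derive x 1 D (q * expR x).
  rewrite /D; apply: is_derive_eq.
  by rewrite add0r mul1r /GRing.scale /=.
pose chi (x : R) := x / 4 + (q - 1) + (1 - q) / D x.
have chi0 x : 0 <= x -> 0 <= chi x.
  move=> x0; have <- : chi 0 = 0.
    by rewrite /chi /D expR0 mulr1 subrK mul0r divr1; lra.
  apply: (@ndecr_from0 _ chi
    (fun y => 4^-1 - (1 - q) * (q * expR y) / D y ^+ 2)) => [y|y _|]; last exact: x0.
    have DV : is_derive y 1 (fun x => (D x)^-1) (- (D y) ^- 2 *: (q * expR y)).
      exact: is_deriveV (lt0r_neq0 (D0 y)) (DD y).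
    have DL : is_derive y 1 (fun x : R => x / 4 + (q - 1)) (4^-1).
      apply: is_derive_eq; rewrite /GRing.scale /= ?mulr0 ?addr0 ?add0r ?mulr1 //.
    have DW : is_derive y 1 (fun x => (1 - q) / D x) ((1 - q) *: (- (D y) ^- 2 *: (q * expR y))).
      exact: (@is_deriveZ _ _ _ (fun x => (D x)^-1)).
    refine (is_derive_eq (is_deriveD DL DW) _).
    by rewrite /GRing.scale /=; congr (_ + _); rewrite mulNr mulrN mulrA mulrAC.
  rewrite subr_ge0 ler_pdivrMr ?exprn_gt0 //.
  (* arithmetic-geometric mean: (1 - q) (q e^y) <= (D y / 2) ^ 2 *)
  have := sqr_ge0 ((1 - q) - q * expR y); rewrite /D; nra.
pose psi (x : R) := x ^+ 2 / 8 + q * x - ln (D x).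
have : 0 <= psi u.
  have <- : psi 0 = 0.
    by rewrite /psi /D expR0 mulr1 subrK ln1 expr0n /= mul0r mulr0; lra.
  apply: (@ndecr_from0 _ psi chi) => [y||]; [|exact: chi0|exact: u0].
  have Dln : is_derive y 1 (@ln R \o D) ((D y)^-1 * (q * expR y)).
    exact: is_derive1_comp (is_derive1_ln (D0 y)) (DD y).
  have DL : is_derive y 1 (fun x : R => x ^+ 2 / 8 + q * x) (y / 4 + q).
    apply: is_derive_eq. rewrite /GRing.scale /=; by field.
  refine (is_derive_eq (is_deriveB DL Dln) _).
  by rewrite /chi /D; field; rewrite -/(D y) lt0r_neq0.
by rewrite /psi subr_ge0.
Qed.

(** * Expectations over finite probability spaces *)

Definition is_pmf (R : realType) (T : finType) (w : T -> R) : Prop :=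
  (forall t, 0 <= w t) /\ \sum_t w t = 1.

Definition mean (R : realType) (T : finType) (w F : T -> R) : R :=
  \sum_t w t * F t.

Section Mean.
Variables (R : realType) (T : finType) (w : T -> R).
Hypothesis w_pmf : is_pmf w.

Lemma eq_mean (F G : T -> R) : F =1 G -> mean w F = mean w G.
Proof. by move=> FG; apply: eq_bigr => t _; rewrite FG. Qed.

Lemma mean_cst (a : R) : mean w (fun=> a) = a.
Proof. by rewrite /mean -mulr_suml w_pmf.2 mul1r. Qed.

Lemma meanD (F G : T -> R) : mean w (fun t => F t + G t) = mean w F + mean w G.
Proof. by rewrite /mean -big_split; apply: eq_bigr => t _; rewrite mulrDr. Qed.

Lemma meanZ (a : R) (F : T -> R) : mean w (fun t => a * F t) = a * mean w F.
Proof. by rewrite /mean mulr_sumr; apply: eq_bigr => t _; rewrite mulrCA. Qed.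

Lemma meanB (F G : T -> R) : mean w (fun t => F t - G t) = mean w F - mean w G.
Proof.
rewrite -[- mean w G]mulN1r -meanZ -meanD.
by apply: eq_mean => t; rewrite mulN1r.
Qed.

Lemma le_mean (F G : T -> R) : (forall t, F t <= G t) -> mean w F <= mean w G.
Proof. by move=> FG; apply: ler_sum => t _; rewrite ler_wpM2l ?w_pmf.1. Qed.

Lemma mean_sum (I : finType) (F : I -> T -> R) :
  mean w (fun t => \sum_i F i t) = \sum_i mean w (F i).
Proof.
rewrite /mean exchange_big /=; apply: eq_bigr => t _; by rewrite mulr_sumr.
Qed.

Lemma jensen_expR (F : T -> R) : expR (mean w F) <= mean w (fun t => expR (F t)).
Proof.
set m := mean w F.
have -> : expR m = mean w (fun t => expR m * (1 + (F t - m))).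
  by rewrite meanZ meanD meanB !mean_cst subrr addr0 mulr1.
apply: le_mean => t; rewrite -ler_pdivlMl ?expR_gt0 //.
rewrite mulrC -expRB; exact: expR_ge1Dx.
Qed.

End Mean.

Lemma exchange_mean (R : realType) (S T : finType) (v : S -> R) (w : T -> R)
    (F : S -> T -> R) :
  mean v (fun s => mean w (F s)) = mean w (fun t => mean v (F^~ t)).
Proof.
rewrite /mean.
under eq_bigr do rewrite mulr_sumr.
rewrite exchange_big; apply: eq_bigr => t _; rewrite mulr_sumr.
by apply: eq_bigr => s _; rewrite mulrCA.
Qed.

(** Negative [u] reduce to positive ones by exchanging the two points. *)
Lemma two_point_mgf (R : realType) (q u : R) : 0 <= q <= 1 ->
  (1 - q + q * expR u) * expR (- (q * u)) <= expR (u ^+ 2 / 8).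
Proof.
have pos (p v : R) : 0 <= p <= 1 -> 0 <= v ->
    (1 - p + p * expR v) * expR (- (p * v)) <= expR (v ^+ 2 / 8).
  move=> p01 v0; have /andP[p0 p1] := p01.
  have D0 : 0 < 1 - p + p * expR v.
    have : p * 1 <= p * expR v by rewrite ler_wpM2l // -expR0 ler_expR.
    lra.
  rewrite -[X in X * _]lnK ?posrE // -expRD ler_expR.
  have := two_point_mgf_pos p01 v0; lra.
move=> q01; case: (leP 0 u) => [|u0]; first exact: pos.
have /andP[q0 q1] := q01.
have posN := @pos (1 - q) (- u); rewrite sqrrN oppr_ge0 in posN.
apply: le_trans (posN _ (ltW u0)); last by apply/andP; split; lra.
rewrite le_eqVlt; apply/orP; left; apply/eqP.
have -> : - ((1 - q) * - u) = u - q * u by ring.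
rewrite expRD mulrA; congr (_ * _).
by rewrite mulrDl -mulrA -expRD addNr expR0; ring.
Qed.

(** By convexity, the exponential lies below its chord, which reduces the
    bound to a variable with values at the two ends of the interval. *)
Lemma hoeffding_mgf (R : realType) (T : finType) (w h : T -> R) (a r l : R) :
  is_pmf w -> 0 <= r -> (forall t, a <= h t <= a + r) ->
  mean w (fun t => expR (l * (h t - mean w h))) <= expR (l ^+ 2 * r ^+ 2 / 8).
Proof.
move=> wP; rewrite le_eqVlt => /orP[/eqP <- hE|r0 hE].
  have E t : h t = a by apply/eqP; rewrite eq_le andbC; have := hE t; rewrite addr0.
  rewrite [X in _ <= X](_ : _ = 1); last by rewrite expr0n /= mulr0 mul0r expR0.
  rewrite le_eqVlt; apply/orP; left; apply/eqP.
  rewrite -[RHS](mean_cst wP); apply: eq_mean => t.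
  by rewrite (eq_mean w E) (mean_cst wP) E subrr mulr0 expR0.
pose s t := (h t - a) / r.
have s01 t : 0 <= s t <= 1.
  have /andP[h1 h2] := hE t.
  by rewrite /s divr_ge0 ?subr_ge0 ?(ltW r0) //= ler_pdivrMr // mul1r lerBlDl.
have hs t : h t = a + r * s t by rewrite /s mulrC divfK ?lt0r_neq0 // subrKC.
pose q := mean w s.
have mh : mean w h = a + r * q.
  by rewrite (eq_mean w hs) meanD mean_cst // meanZ.
have q01 : 0 <= q <= 1.
  apply/andP; split.
    by rewrite -(mean_cst wP 0); apply: le_mean => // t; case/andP: (s01 t).
  by rewrite -(mean_cst wP 1); apply: le_mean => // t; case/andP: (s01 t).
have -> : l ^+ 2 * r ^+ 2 = (l * r) ^+ 2 by rewrite exprMn.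
apply: le_trans (two_point_mgf (l * r) q01).
rewrite [leRHS](_ : _ = mean w (fun t =>
    expR (- (q * (l * r))) * (1 - s t + s t * expR (l * r)))); last first.
  rewrite meanZ mulrC; congr (_ * _); rewrite meanD meanB mean_cst //.
  by congr (_ + _); rewrite mulrC -meanZ; apply: eq_mean => t; rewrite mulrC.
apply: le_mean => // t.
have -> : l * (h t - mean w h) = - (q * (l * r)) + s t * (l * r).
  by rewrite hs mh; ring.
rewrite expRD ler_wpM2l ?expR_ge0 //.
have /andP[s0 s1] := s01 t.
have := @convex_expR R (Itv01 s0 s1) (l * r) 0; rewrite !convRE /=.
rewrite mulr0 addr0 expR0 mulr1 addrC => /le_trans; apply.
by [].
Qed.

(** * Finite samples: bounded differences and the change of measure *)

(** The expectation over an independent sample, written as an iterated sum so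
    that conditioning on the first observation is a reduction step. *)
Fixpoint Esample (R : realType) (V : finType) (p : V -> R) (n : nat)
    (F : seq V -> R) : R :=
  if n is m.+1 then mean p (fun v => Esample p m (fun s => F (v :: s)))
  else F [::].

Section Samples.
Variables (R : realType) (V : finType) (p : V -> R).
Hypothesis p_pmf : is_pmf p.

Lemma le_Esample n (F G : seq V -> R) :
  (forall s, size s = n -> F s <= G s) -> Esample p n F <= Esample p n G.
Proof.
elim: n F G => [|n IH] F G FG /=; first exact: FG.
by apply: le_mean => // v; apply: IH => s sn; apply: FG; rewrite /= sn.
Qed.

Lemma eq_Esample n (F G : seq V -> R) :
  (forall s, size s = n -> F s = G s) -> Esample p n F = Esample p n G.
Proof.
by move=> FG; apply/eqP; rewrite eq_le !le_Esample // => s sn; rewrite FG.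
Qed.

Lemma Esample_cst n (a : R) : Esample p n (fun=> a) = a.
Proof. by elim: n => //= n IH; rewrite IH mean_cst. Qed.

Lemma EsampleD n (F G : seq V -> R) :
  Esample p n (fun s => F s + G s) = Esample p n F + Esample p n G.
Proof.
elim: n F G => //= n IH F G; rewrite -meanD; by apply: eq_mean => v; exact: IH.
Qed.

Lemma EsampleZ n (a : R) (F : seq V -> R) :
  Esample p n (fun s => a * F s) = a * Esample p n F.
Proof.
elim: n F => //= n IH F; rewrite -meanZ; by apply: eq_mean => v; exact: IH.
Qed.

Lemma EsampleB n (F G : seq V -> R) :
  Esample p n (fun s => F s - G s) = Esample p n F - Esample p n G.
Proof.
rewrite -[- Esample p n G]mulN1r -EsampleZ -EsampleD.
by apply: eq_Esample => s _; rewrite mulN1r.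
Qed.

Lemma Esample_mean (S : finType) (w : S -> R) n (F : S -> seq V -> R) :
  Esample p n (fun s => mean w (fun t => F t s)) = mean w (fun t => Esample p n (F t)).
Proof.
elim: n F => //= n IH F; rewrite -exchange_mean.
by apply: eq_mean => v; rewrite IH.
Qed.

Definition bounded_differences (n : nat) (c : R) (F : seq V -> R) : Prop :=
  forall s1 v v' s2, size (s1 ++ v :: s2) = n ->
    F (s1 ++ v :: s2) - F (s1 ++ v' :: s2) <= c.

(** Integrating out the coordinates one at a time: the conditional mean given
    the first coordinate oscillates by at most [c], so that each coordinate
    contributes one factor of Hoeffding's bound. *)
Lemma mcdiarmid_mgf n (c l : R) (F : seq V -> R) : 0 <= c ->
  bounded_differences n c F ->
  Esample p n (fun s => expR (l * F s))
    <= expR (l * Esample p n F + n%:R * (l ^+ 2 * c ^+ 2 / 8)).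
Proof.
move=> c0; elim: n F => [|n IH] F bF /=; first by rewrite mul0r addr0.
pose G v := Esample p n (fun s => F (v :: s)).
have G_osc v v' : G v - G v' <= c.
  rewrite /G -EsampleB -[leRHS](Esample_cst n).
  by apply: le_Esample => s sn; apply: (bF [::] v v' s); rewrite /= sn.
have step v : Esample p n (fun s => expR (l * F (v :: s)))
    <= expR (l * (G v - mean p G)) *
       expR (l * mean p G + n%:R * (l ^+ 2 * c ^+ 2 / 8)).
  rewrite -expRD; apply: le_trans (IH _ _) _.
    by move=> s1 x x' s2 sn; apply: (bF (v :: s1)); rewrite /= sn.
  by rewrite ler_expR -/(G v) le_eqVlt; apply/orP; left; apply/eqP; ring.
apply: le_trans (le_mean p_pmf step) _.
rewrite [leLHS](_ : _ = expR (l * mean p G + n%:R * (l ^+ 2 * c ^+ 2 / 8)) *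
    mean p (fun v => expR (l * (G v - mean p G)))); last first.
  rewrite -[RHS]meanZ; apply: eq_mean => v; exact: mulrC.
rewrite -/G [leRHS](_ : _ = expR (l * mean p G + n%:R * (l ^+ 2 * c ^+ 2 / 8)) *
    expR (l ^+ 2 * c ^+ 2 / 8)); last first.
  by rewrite -expRD -natr1; congr expR; ring.
rewrite ler_wpM2l ?expR_ge0 //.
have [v0 vmin] : exists v0, forall v, G v0 <= G v.
  have [v0|noV] := pickP (xpredT : pred V); last first.
    have := p_pmf.2; rewrite big_pred0 // => /esym/eqP; by rewrite oner_eq0.
  case: (@arg_minP _ _ _ v0 xpredT G) => // v1 _ H _; by exists v1 => v; exact: H.
apply: (@hoeffding_mgf _ _ _ _ (G v0)) => // v.
by rewrite vmin /= -lerBlDl G_osc.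
Qed.

(** The Chernoff bound applied to the previous lemma, with the optimal
    parameter [4 t / (n c^2)]. *)
Lemma mcdiarmid n (c t : R) (F : seq V -> R) (Q : pred (seq V)) :
  (0 < n)%N -> 0 < c -> 0 <= t -> bounded_differences n c F ->
  (forall s, Q s -> Esample p n F + t <= F s) ->
  Esample p n (fun s => (Q s)%:R) <= expR (- (2 * t ^+ 2 / (n%:R * c ^+ 2))).
Proof.
move=> n0 c0 t0 bF QF.
have n0R : 0 < n%:R :> R by rewrite ltr0n.
pose l := 4 * t / (n%:R * c ^+ 2).
have l0 : 0 <= l by apply: divr_ge0; rewrite mulr_ge0 ?sqr_ge0 ?(ltW n0R).
apply: (@le_trans _ _ (expR (- (l * (Esample p n F + t))) *
    Esample p n (fun s => expR (l * F s)))).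
  rewrite -EsampleZ; apply: le_Esample => s _.
  case: (boolP (Q s)) => [/QF Qs|_]; last by rewrite mulr_ge0 ?expR_ge0.
  rewrite -expRD -[leLHS]expR0 ler_expR addrC subr_ge0 ler_wpM2l //.
apply: le_trans (ler_wpM2l (expR_ge0 _) (mcdiarmid_mgf l (ltW c0) bF)) _.
rewrite -expRD ler_expR le_eqVlt; apply/orP; left; apply/eqP.
by rewrite /l; field; rewrite !lt0r_neq0.
Qed.

Definition dev (h : V -> R) (s : seq V) : R :=
  (size s)%:R^-1 * (\sum_(v <- s) h v) - mean p h.

Lemma dev_le (h : V -> R) (a b : R) s : (0 < size s)%N ->
  (forall v, a <= h v <= b) -> dev h s <= b - a.
Proof.
move=> s0 hab; apply: lerB; last first.
  by rewrite -(mean_cst p_pmf a); apply: le_mean => // v; case/andP: (hab v).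
rewrite ler_pdivrMl ?ltr0n //.
elim: s {s0} => [|v s IH] /=; first by rewrite big_nil mul0r.
by rewrite big_cons -natr1 mulrDl mul1r addrC lerD //; case/andP: (hab v).
Qed.

Lemma eq_dev (h g : V -> R) s : h =1 g -> dev h s = dev g s.
Proof.
by move=> hg; congr (_ * _ - _); [apply: eq_bigr | apply: eq_mean].
Qed.

Lemma devD (h g : V -> R) s : dev (fun v => h v + g v) s = dev h s + dev g s.
Proof. by rewrite /dev big_split /= mulrDr meanD opprD addrACA. Qed.

Lemma devN (h : V -> R) s : dev (fun v => - h v) s = - dev h s.
Proof.
rewrite /dev sumrN mulrN opprD opprK; congr (_ + _).
by rewrite -mulN1r -meanZ; apply: eq_mean => v; rewrite mulN1r opprK.
Qed.

Lemma devZ a (h : V -> R) s : dev (fun v => a * h v) s = a * dev h s.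
Proof. by rewrite /dev -mulr_sumr meanZ mulrCA mulrBr. Qed.

Lemma dev_sum (I : finType) (h : I -> V -> R) s :
  dev (fun v => \sum_i h i v) s = \sum_i dev (h i) s.
Proof.
by rewrite /dev exchange_big mean_sum mulr_sumr -sumrB.
Qed.

Lemma dev_mean (S : finType) (w : S -> R) (h : S -> V -> R) s :
  dev (fun v => mean w (fun t => h t v)) s = mean w (fun t => dev (h t) s).
Proof. by rewrite dev_sum; apply: eq_bigr => t _; rewrite devZ. Qed.

Lemma dev_bounded_differences (h : V -> R) (a r : R) n : 
  (forall v, a <= h v <= a + r) -> bounded_differences n (r / n%:R) (dev h).
Proof.
move=> har s1 v v' s2 sn; rewrite /dev.
have -> : size (s1 ++ v' :: s2) = n by rewrite -sn !size_cat.
rewrite sn !big_cat !big_cons /=.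
set A := \sum_(_ <- s1) _; set B := \sum_(_ <- s2) _.
rewrite [leLHS](_ : _ = (h v - h v') / n%:R); last by ring.
have [/andP[? ?] /andP[? ?]] := (har v, har v').
by rewrite ler_wpM2r ?invr_ge0 //; lra.
Qed.

Lemma Esample_dev (h : V -> R) n : (0 < n)%N -> Esample p n (dev h) = 0.
Proof.
move=> n0; rewrite (eq_Esample (G := fun s => n%:R^-1 * (\sum_(v <- s) h v) - mean p h));
  last by move=> s sn; rewrite /dev sn.
rewrite EsampleB Esample_cst EsampleZ.
have -> : Esample p n (fun s => \sum_(v <- s) h v) = n%:R * mean p h.
  elim: n {n0} => [|n IH] /=; first by rewrite big_nil mul0r.
  rewrite -natr1 mulrDl mul1r addrC -IH -[X in _ + X](mean_cst p_pmf) -meanD.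
  apply: eq_mean => v; rewrite -[X in X + _](Esample_cst n) -EsampleD.
  by apply: eq_Esample => s _; rewrite big_cons.
by rewrite mulKf ?subrr // pnatr_eq0 -lt0n.
Qed.

Lemma dev_mgf (h : V -> R) (a r l : R) n : (0 < n)%N -> 0 <= r ->
  (forall v, a <= h v <= a + r) ->
  Esample p n (fun s => expR (l * dev h s)) <= expR (l ^+ 2 * r ^+ 2 / (8 * n%:R)).
Proof.
move=> n0 r0 har.
have n0R : n%:R != 0 :> R by rewrite pnatr_eq0 -lt0n.
apply: le_trans (mcdiarmid_mgf l _ (dev_bounded_differences har)) _.
  by rewrite divr_ge0.
rewrite Esample_dev // mulr0 add0r ler_expR le_eqVlt; apply/orP; left; apply/eqP.
by field.
Qed.

(** The PAC-Bayesian inequality, with a chi-square divergence.  For each sample,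
    Jensen's inequality followed by
    [2 rho e^(G/2) <= (rho ^ 2 / pi) e^(-K) + pi e^(G + K)] compares the
    posterior [rho], which may depend on the sample, with the prior [pi], which
    does not: the expectation over the sample can then be taken inside. *)
Lemma pac_bayes (S Q : finType) (pi : S -> R) (rho : Q -> S -> R) (K Psi : R)
    n (F : S -> seq V -> R) (q : seq V -> Q) :
  is_pmf pi -> (forall t, 0 < pi t) ->
  (forall i, is_pmf (rho i)) ->
  (forall i, \sum_t rho i t ^+ 2 / pi t <= expR K) ->
  (forall t, Esample p n (fun s => expR (F t s)) <= expR Psi) ->
  Esample p n (fun s => mean (rho (q s)) (fun t => F t s)) <= K + Psi.
Proof.
move=> piP pi0 rhoP chi mgf.
have key s : mean (rho (q s)) (fun t => F t s) - (K + Psi) <=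
    expR (- Psi) * mean pi (fun t => expR (F t s)) - 1.
  set x := mean _ _ - _; set y := mean pi _.
  have : expR (x / 2) <= (1 + expR (- Psi) * y) / 2.
    have -> : x / 2 = mean (rho (q s)) (fun t => 2^-1 * (F t s - (K + Psi))).
      by rewrite meanZ meanB (mean_cst (rhoP _)) mulrC.
    apply: le_trans (jensen_expR (rhoP _) _) _.
    rewrite mulrDl mul1r; apply: (@le_trans _ _
      (\sum_t (rho (q s) t ^+ 2 / pi t * (expR (- K) / 2) +
               pi t * expR (F t s) * (expR (- Psi) / 2)))).
      apply: ler_sum => t _.
      have -> : 2^-1 * (F t s - (K + Psi)) = (F t s - Psi) / 2 + - K / 2 by field.
      rewrite expRD; set a := expR ((F t s - Psi) / 2); set b := expR (- K / 2).
      have -> : pi t * expR (F t s) * (expR (- Psi) / 2) = pi t * a ^+ 2 / 2.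
        rewrite -expRM_natr mulfVK ?pnatr_eq0 // expRD; ring.
      have -> : expR (- K) = b ^+ 2 by rewrite -expRM_natr mulfVK ?pnatr_eq0.
      rewrite -subr_ge0 (_ : _ - _ =
        pi t / 2 * (rho (q s) t / pi t * b - a) ^+ 2); last first.
        by field; rewrite lt0r_neq0.
      by rewrite mulr_ge0 ?sqr_ge0 // divr_ge0 // ltW.
    rewrite big_split /= -!mulr_suml lerD //; last first.
      by rewrite -/(mean pi _) -/y mulrCA mulrA.
    rewrite mulrA ler_pdivrMr // mulVf ?pnatr_eq0 //.
    by rewrite expRN ler_pdivrMr ?expR_gt0 // mul1r.
  have := expR_ge1Dx (x / 2); lra.
rewrite -subr_le0 -[X in _ - X](Esample_cst n) -EsampleB.
apply: le_trans (le_Esample (fun s _ => key s)) _.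
rewrite EsampleB Esample_cst EsampleZ Esample_mean subr_le0 expRN.
rewrite ler_pdivrMl ?expR_gt0 // mulr1 -[leRHS](mean_cst piP).
exact: le_mean.
Qed.

(** Optimizing the inverse temperature in the previous lemma. *)
Lemma pac_bayes_dev (S Q : finType) (pi : S -> R) (rho : Q -> S -> R) (K r : R)
    n (h : S -> V -> R) (a : S -> R) (q : seq V -> Q) :
  (0 < n)%N -> 0 < K -> 0 < r ->
  is_pmf pi -> (forall t, 0 < pi t) -> (forall i, is_pmf (rho i)) ->
  (forall i, \sum_t rho i t ^+ 2 / pi t <= expR K) ->
  (forall t v, a t <= h t v <= a t + r) ->
  Esample p n (fun s => dev (fun v => mean (rho (q s)) (fun t => h t v)) s)
    <= r * Num.sqrt (K / (2 * n%:R)).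
Proof.
move=> n0 K0 r0 piP pi0 rhoP chi har.
have n0R : 0 < n%:R :> R by rewrite ltr0n.
set x := K / (2 * n%:R).
have x0 : 0 < x by rewrite divr_gt0 ?mulr_gt0.
pose y := Num.sqrt x; have y0 : 0 < y by rewrite sqrtr_gt0.
have yx : y ^+ 2 = x by rewrite sqr_sqrtr ?(ltW x0).
pose l := 4 * n%:R * y / r.
have l0 : 0 < l by rewrite divr_gt0 ?mulr_gt0.
have := @pac_bayes S Q pi rho K (l ^+ 2 * r ^+ 2 / (8 * n%:R)) n
  (fun t s => l * dev (h t) s) q piP pi0 rhoP chi
  (fun t => dev_mgf l n0 (ltW r0) (har t)).
rewrite (eq_Esample (G := fun s => l * dev (fun v => mean (rho (q s)) (fun t => h t v)) s));
  last by move=> s _; rewrite meanZ dev_mean.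
rewrite EsampleZ -ler_pdivlMl // => /le_trans; apply.
have -> : K = 2 * n%:R * y ^+ 2 by rewrite yx /x mulrC divfK // lt0r_neq0 // mulr_gt0.
rewrite -/y le_eqVlt; apply/orP; left; apply/eqP.
by rewrite /l; field; rewrite !lt0r_neq0.
Qed.

End Samples.

(** * Random sign vectors and their averages *)

Section Signs.
Variables (R : realType) (J : finType).

Definition pm1 (b : bool) : R := if b then 1 else -1.

Definition sign_pmf (m : R) (b : bool) : R := (1 + m * pm1 b) / 2.

Lemma mean_sign_pmf (m : R) (F : bool -> R) :
  mean (sign_pmf m) F = (1 + m) / 2 * F true + (1 - m) / 2 * F false.
Proof. by rewrite /mean big_bool /sign_pmf /= mulr1 mulrN1. Qed.

Lemma sign_pmfP (m : R) : `|m| <= 1 -> is_pmf (sign_pmf m).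
Proof.
rewrite ler_norml => /andP[m1 m2]; split.
  by case; rewrite /sign_pmf /=; lra.
by rewrite big_bool /sign_pmf /=; field.
Qed.

Lemma mean_pair (S T : finType) (v : S -> R) (w : T -> R) (F : S * T -> R) :
  mean (fun x => v x.1 * w x.2) F = mean v (fun s => mean w (fun t => F (s, t))).
Proof.
rewrite /mean; under [RHS]eq_bigr do rewrite mulr_sumr.
by rewrite pair_bigA /=; apply: eq_bigr => -[s t] _; rewrite mulrA.
Qed.

Lemma mean_prod (w g : J -> bool -> R) :
  mean (fun s : {ffun J -> bool} => \prod_j w j (s j)) (fun s => \prod_j g j (s j))
  = \prod_j mean (w j) (g j).
Proof.
rewrite /mean (bigA_distr_bigA (fun j b => w j b * g j b)).
by apply: eq_bigr => s _; rewrite big_split.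
Qed.

(** Sign vectors sit at the [2 ^ p] leaves of a complete binary tree: doubling
    their number is then pairing, and properties of averages follow by induction
    on the level. *)
Fixpoint cloud (p : nat) : finType :=
  if p is q.+1 then (cloud q * cloud q)%type : finType
  else {ffun J -> bool} : finType.

(** The law under which [average] is an unbiased noisy version of [m]. *)
Fixpoint cloud_pmf (m : J -> R) (p : nat) : cloud p -> R :=
  match p return cloud p -> R with
  | 0 => fun s => \prod_j sign_pmf (m j) (s j)
  | q.+1 => fun s => cloud_pmf m s.1 * cloud_pmf m s.2
  end.

Fixpoint average (p : nat) : cloud p -> J -> R :=
  match p return cloud p -> J -> R with
  | 0 => fun s j => pm1 (s j)
  | q.+1 => fun s j => (average s.1 j + average s.2 j) / 2
  end.

(** The passage from a cloud of level [p.+1], that is a pair, to a cloud of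
    level [p]: when the mask [t] is fair, the average of the result is the
    average of the pair plus a centred noise. *)
Fixpoint splice (p : nat) : cloud p -> cloud p -> cloud p -> cloud p :=
  match p return cloud p -> cloud p -> cloud p -> cloud p with
  | 0 => fun t a b => [ffun j => if t j then a j else b j]
  | q.+1 => fun t a b => (splice t.1 a.1 b.1, splice t.2 a.2 b.2)
  end.

Definition fair (p : nat) : cloud p -> R := @cloud_pmf (fun=> 0) p.

Lemma cloud_pmfP (m : J -> R) p : (forall j, `|m j| <= 1) -> is_pmf (@cloud_pmf m p).
Proof.
move=> m1; elim: p => [|p [IH0 IH1]]; split => /=.
- by move=> s; apply: prodr_ge0 => j _; case: (sign_pmfP (m1 j)).
- rewrite -(bigA_distr_bigA (fun j b => sign_pmf (m j) b)) big1 // => j _.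
  by case: (sign_pmfP (m1 j)).
- by move=> s; rewrite mulr_ge0.
- rewrite -(pair_bigA _ (fun a b => cloud_pmf m a * cloud_pmf m b)) /=.
  by under eq_bigr do rewrite -mulr_sumr IH1 mulr1.
Qed.

Lemma fairP p : is_pmf (@fair p).
Proof. by apply: cloud_pmfP => j; rewrite normr0. Qed.

Lemma fair_gt0 p (s : cloud p) : 0 < fair s.
Proof.
rewrite /fair; elim: p s => /= [|p IH] s; last by rewrite mulr_gt0.
by apply: prodr_gt0 => j _; rewrite /sign_pmf mul0r addr0 divr_gt0.
Qed.

(** For one sign of mean [m], the chi-square term is [1 + m ^ 2], and it is
    multiplicative over independent signs. *)
Lemma chi2_cloud (m : J -> R) p :
  \sum_s cloud_pmf m s ^+ 2 / @fair p s <= expR (2 ^+ p * \sum_j m j ^+ 2).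
Proof.
elim: p => [|p IH] /=.
  rewrite mul1r expR_sum.
  rewrite [leLHS](_ : _ = \sum_(s : {ffun J -> bool})
      \prod_j (sign_pmf (m j) (s j) ^+ 2 / sign_pmf 0 (s j))); last first.
    by apply: eq_bigr => s _; rewrite -prodrXl -prodfV -big_split.
  rewrite -(bigA_distr_bigA (fun j b => sign_pmf (m j) b ^+ 2 / sign_pmf 0 b)).
  apply: ler_prod => j _; rewrite big_bool /sign_pmf /= !mul0r !addr0.
  rewrite [X in 0 <= X <= _](_ : _ = 1 + m j ^+ 2); last by field.
  by rewrite expR_ge1Dx addr_ge0 // sqr_ge0.
rewrite [leLHS](_ : _ = (\sum_s cloud_pmf m s ^+ 2 / @fair p s) *
   (\sum_s cloud_pmf m s ^+ 2 / @fair p s)); last first.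
  rewrite mulr_suml; under [RHS]eq_bigr do rewrite mulr_sumr.
  rewrite pair_bigA /=; apply: eq_bigr => -[a b] _ /=.
  by rewrite /fair /= exprMn invfM mulrACA.
rewrite (_ : 2 ^+ p.+1 * _ = 2 ^+ p * (\sum_j m j ^+ 2) + 2 ^+ p * (\sum_j m j ^+ 2));
  last by rewrite exprS; ring.
rewrite expRD; apply: ler_pM => //; apply: sumr_ge0 => s _;
  by rewrite divr_ge0 ?sqr_ge0 // ltW // fair_gt0.
Qed.

Lemma mgf_signs (w : J -> bool -> R) (g : J -> bool -> R) (t : J -> R) :
  (forall j, is_pmf (w j)) -> (forall j, mean (w j) (g j) = 0) ->
  (forall j b b', g j b - g j b' <= 2) ->
  mean (fun s : {ffun J -> bool} => \prod_j w j (s j))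
       (fun s => expR (\sum_j t j * g j (s j)))
  <= expR ((\sum_j t j ^+ 2) / 2).
Proof.
move=> wP g0 g2; rewrite (eq_mean _ (G := fun s : {ffun J -> bool} =>
    \prod_j expR (t j * g j (s j)))); last by move=> s; exact: expR_sum.
rewrite (mean_prod w (fun j b => expR (t j * g j b))) mulr_suml expR_sum.
apply: ler_prod => j _; apply/andP; split.
  by apply: sumr_ge0 => b _; rewrite mulr_ge0 ?expR_ge0 ?(wP j).1.
have := @hoeffding_mgf R _ (w j) (g j) (Num.min (g j true) (g j false)) 2 (t j) (wP j).
rewrite g0; under eq_mean do rewrite subr0.
have -> : t j ^+ 2 * 2 ^+ 2 / 8 = t j ^+ 2 / 2 by field.
apply=> // b; have := g2 j true false; have := g2 j false true.
by case: b; case: (leP (g j true) (g j false)) => *; apply/andP; split; lra.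
Qed.

(** Both perturbations used below, that of the parameter by a cloud around it
    and that of a cloud by splicing, are sub-Gaussian; halving the tree halves
    the variance proxy at each level. *)
Lemma mgf_average (m : J -> R) p (t : J -> R) : (forall j, `|m j| <= 1) ->
  mean (@cloud_pmf m p) (fun s => expR (\sum_j t j * (average s j - m j)))
  <= expR ((\sum_j t j ^+ 2) / (2 * 2 ^+ p)).
Proof.
move=> m1; elim: p t => [|p IH] t /=.
  rewrite mulr1; apply: (mgf_signs (w := fun j => sign_pmf (m j))
    (g := fun j b => pm1 b - m j)) => [j|j|j b b'].
  - exact: sign_pmfP.
  - by rewrite mean_sign_pmf /=; field.
  - by case: b b' => -[] /=; lra.
rewrite mean_pair (eq_mean _ (G := fun a =>
    expR (\sum_j t j / 2 * (average a j - m j)) * mean (@cloud_pmf m p) (fun b =>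
    expR (\sum_j t j / 2 * (average b j - m j))))); last first.
  move=> a; rewrite -meanZ; apply: eq_mean => b; rewrite -expRD -big_split /=.
  by congr expR; apply: eq_bigr => j _; field.
rewrite (eq_mean _ (G := fun a => mean (@cloud_pmf m p) (fun b =>
    expR (\sum_j t j / 2 * (average b j - m j))) *
    expR (\sum_j t j / 2 * (average a j - m j)))); last by move=> a; exact: mulrC.
rewrite meanZ (_ : (\sum_j _) / _ = (\sum_j (t j / 2) ^+ 2) / (2 * 2 ^+ p) +
    (\sum_j (t j / 2) ^+ 2) / (2 * 2 ^+ p)); last first.
  under [in RHS]eq_bigr do rewrite expr_div_n.
  by rewrite -mulr_suml exprS; field; rewrite expf_neq0 ?pnatr_eq0.
rewrite expRD; have cP := @cloud_pmfP m p m1.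
by apply: ler_pM => //; apply: sumr_ge0 => s _; rewrite mulr_ge0 ?expR_ge0 ?cP.1.
Qed.

Lemma mgf_splice p (a b : cloud p) (t : J -> R) :
  mean (@fair p) (fun s =>
    expR (\sum_j t j * (average (splice s a b) j - (average a j + average b j) / 2)))
  <= expR ((\sum_j t j ^+ 2) / (2 * 2 ^+ p)).
Proof.
elim: p a b t => [|p IH] a b t /=.
  rewrite mulr1 (eq_mean _ (G := fun s : {ffun J -> bool} => expR (\sum_j t j *
      (pm1 (if s j then a j else b j) - (pm1 (a j) + pm1 (b j)) / 2)))); last first.
    by move=> s; congr expR; apply: eq_bigr => j _; rewrite ffunE.
  apply: (mgf_signs (w := fun=> sign_pmf 0) (g := fun j s =>
      pm1 (if s then a j else b j) - (pm1 (a j) + pm1 (b j)) / 2)) => [j|j|j s s'].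
  - by apply: sign_pmfP; rewrite normr0.
  - by rewrite mean_sign_pmf /=; field.
  - by case: s s' => -[]; case: (a j); case: (b j) => /=; lra.
rewrite /fair /= mean_pair (eq_mean _ (G := fun s =>
    mean (@fair p) (fun s' => expR (\sum_j t j / 2 *
      (average (splice s' a.2 b.2) j - (average a.2 j + average b.2 j) / 2))) *
    expR (\sum_j t j / 2 *
      (average (splice s a.1 b.1) j - (average a.1 j + average b.1 j) / 2)))); last first.
  move=> s; rewrite mulrC -meanZ; apply: eq_mean => s'; rewrite -expRD -big_split /=.
  by congr expR; apply: eq_bigr => j _; field.
rewrite meanZ (_ : (\sum_j _) / _ = (\sum_j (t j / 2) ^+ 2) / (2 * 2 ^+ p) +
    (\sum_j (t j / 2) ^+ 2) / (2 * 2 ^+ p)); last first.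
  under [in RHS]eq_bigr do rewrite expr_div_n.
  by rewrite -mulr_suml exprS; field; rewrite expf_neq0 ?pnatr_eq0.
rewrite expRD; have cP := @fairP p.
apply: ler_pM; [| |exact: IH|exact: IH];
  by apply: sumr_ge0 => s _; rewrite mulr_ge0 ?expR_ge0 ?cP.1.
Qed.

(** Splicing two independent clouds of the same law produces a cloud of that
    law, whatever the mask: exchanging the signs selected by the mask
    preserves the law of the pair. *)
Lemma splice_law (m : J -> R) p (t : cloud p) (F : cloud p -> R) :
  (forall j, `|m j| <= 1) ->
  mean (@cloud_pmf m p) (fun a => mean (@cloud_pmf m p) (fun b => F (splice t a b)))
  = mean (@cloud_pmf m p) F.
Proof.
move=> m1; elim: p t F => [|p IH] t F.
  set w := @cloud_pmf m 0; have wP : is_pmf w by exact: cloud_pmfP.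
  pose mix (x : cloud 0 * cloud 0) := (splice t x.1 x.2, splice t x.2 x.1).
  have mixK : involutive mix.
    by move=> [a b]; congr pair; apply/ffunP => j; rewrite !ffunE; case: (t j).
  rewrite -(mean_pair w w (fun x => F (splice t x.1 x.2))).
  transitivity (mean (fun x => w x.1 * w x.2) (fun x => F x.1)); last first.
    by rewrite mean_pair /=; apply: eq_mean => a; rewrite mean_cst.
  rewrite /mean [RHS](reindex mix) /=; last by exists mix => x _; exact: mixK.
  apply: eq_bigr => -[a b] _ /=; congr (_ * _); rewrite -!big_split /=.
  by apply: eq_bigr => j _; rewrite !ffunE; case: (t j); rewrite // mulrC.
rewrite /= mean_pair; under eq_mean do under eq_mean do rewrite mean_pair.
rewrite mean_pair -[RHS](IH t.1); apply: eq_mean => a1.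
rewrite exchange_mean; apply: eq_mean => b1.
exact: (IH t.2 (fun x => F (splice t.1 a1 b1, x))).
Qed.

End Signs.

(** * Sub-Gaussian perturbations of a clipped maximum *)

Definition subgaussian (R : realType) (T : finType) (w : T -> R) (s2 : R)
    (Y : T -> R) : Prop :=
  forall l, mean w (fun t => expR (l * Y t)) <= expR (l ^+ 2 * s2 / 2).

Section Subgaussian.
Variables (R : realType) (T : finType) (w : T -> R).
Hypothesis w_pmf : is_pmf w.

(** Jensen's inequality bounds [l * mean w Y] by [l ^ 2 * s2 / 2] for all [l];
    the term of first order has to vanish. *)
Lemma subgaussian_centered (s2 : R) (Y : T -> R) : 0 < s2 ->
  subgaussian w s2 Y -> mean w Y = 0.
Proof.
move=> s0 sY; set m := mean w Y.
have mle l : l * m <= l ^+ 2 * s2 / 2.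
  by rewrite -ler_expR -meanZ; apply: le_trans (jensen_expR w_pmf _) (sY l).
apply/eqP; rewrite -sqrf_eq0 eq_le sqr_ge0 andbT.
have := mle (m / s2).
rewrite (_ : m / s2 * m = m ^+ 2 / s2); last by rewrite mulrAC.
rewrite (_ : _ / 2 = m ^+ 2 / s2 / 2); last by field; rewrite lt0r_neq0.
rewrite -[leRHS]addr0 -lerBlDl (_ : _ - _ = m ^+ 2 / (2 * s2)); last first.
  by field; rewrite lt0r_neq0.
by rewrite ler_pdivrMr ?mulr_gt0 // mul0r.
Qed.

(** The exponential of the maximum is at most the sum of the [2 * #|I|]
    exponentials; the parameter is then optimized. *)
Lemma subgaussian_max (I : finType) (s2 : R) (Y : I -> T -> R) :
  (0 < #|I|)%N -> 0 < s2 -> (forall i, subgaussian w s2 (Y i)) ->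
  mean w (fun t => \big[Num.max/0]_i `|Y i t|)
    <= Num.sqrt (s2 * (2 * ln (2 * #|I|%:R))).
Proof.
move=> I0 s0 sY; set M := mean _ _; set k := #|I| in I0 *.
have k1 : 1 <= k%:R :> R by rewrite ler1n.
set L := ln (2 * k%:R).
have L0 : 0 < L by apply: ln_gt0; lra.
have tail l : 0 < l -> l * M <= L + l ^+ 2 * s2 / 2.
  move=> l0; rewrite -ler_expR expRD lnK ?posrE; last by lra.
  rewrite /M -meanZ; apply: le_trans (jensen_expR w_pmf _) _.
  apply: (@le_trans _ _ (mean w (fun t =>
      \sum_i (expR (l * Y i t) + expR (- l * Y i t))))).
    apply: le_mean => // t; set S := \sum_i _.
    have Y2 i : 1 <= expR (l * Y i t) + expR (- l * Y i t).
      have := expR_ge1Dx (l * Y i t); have := expR_ge1Dx (- l * Y i t).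
      by rewrite mulNr; lra.
    have iS i : expR (l * Y i t) + expR (- l * Y i t) <= S.
      rewrite /S (bigD1 i) //= lerDl; apply: sumr_ge0 => j _.
      exact: le_trans ler01 (Y2 j).
    have [i0 _] : exists i : I, i \in I by apply/card_gt0P.
    have S1 : 1 <= S by exact: le_trans (Y2 i0) (iS i0).
    have S0 : 0 < S by exact: lt_le_trans ltr01 S1.
    rewrite -[S]lnK ?posrE // ler_expR -ler_pdivlMl //.
    apply: bigmax_le => [|i _].
      by rewrite mulr_ge0 ?invr_ge0 ?(ltW l0) // ln_ge0.
    rewrite ler_pdivlMl // -ler_expR lnK ?posrE //; apply: le_trans (iS i).
    case: (ger0P (Y i t)) => _; first by rewrite lerDl expR_ge0.
    by rewrite mulrN mulNr lerDr expR_ge0.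
  rewrite mean_sum // (_ : 2 * k%:R * _ = \sum_(i : I) (2 * expR (l ^+ 2 * s2 / 2))); last first.
    by rewrite sumr_const -mulr_natr -/k; ring.
  apply: ler_sum => i _; rewrite meanD mulr2n mulrDl mul1r lerD //; first exact: sY.
  by have := sY i (- l); rewrite sqrrN.
set S := Num.sqrt _.
have x0 : 0 < s2 * (2 * L) by rewrite !mulr_gt0.
have S0 : 0 < S by rewrite sqrtr_gt0.
have S2 : S ^+ 2 = s2 * (2 * L) by rewrite sqr_sqrtr // ltW.
have := tail (S / s2) (divr_gt0 S0 s0).
have -> : (S / s2) ^+ 2 * s2 / 2 = L.
  by rewrite exprMn S2; field; rewrite lt0r_neq0.
rewrite -[M <= S](ler_pM2l (divr_gt0 S0 s0)) => /le_trans; apply.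
by rewrite mulrAC -expr2 S2 le_eqVlt; apply/orP; left; apply/eqP; field; rewrite lt0r_neq0.
Qed.

Lemma subgaussian_abs (s2 : R) (Y : T -> R) : 0 < s2 -> subgaussian w s2 Y ->
  mean w (fun t => `|Y t|) <= Num.sqrt (s2 * (2 * ln 2)).
Proof.
move=> s0 sY; have := @subgaussian_max unit s2 (fun=> Y).
rewrite card_unit mulr1 => /(_ isT s0 (fun=> sY)); apply: le_trans.
by apply: le_mean => // t; rewrite (bigD1 tt) //= le_max lexx.
Qed.

End Subgaussian.

Section Crest.
Variables (R : realType) (I : finType).

(** The clipping leaves the Gaussian criterion unchanged but bounds the maxima
    of linear forms at noisy parameters, without which the coarsest level of the
    chaining could not be controlled. *)
Definition crest (y : I -> R) : R := Num.min 1 (\big[Num.max/0]_i y i).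

Lemma crest01 y : 0 <= crest y <= 1.
Proof.
rewrite /crest le_min ge_min lexx ler01 /= andbT.
by apply: bigmax_ge_id.
Qed.

Lemma crest_lipschitz (y z : I -> R) :
  crest y <= crest z + \big[Num.max/0]_i `|y i - z i|.
Proof.
set D := \big[_/_]_i `|_|; have D0 : 0 <= D by exact: bigmax_ge_id.
rewrite -lerBlDr /crest le_min !lerBlDr; apply/andP; split.
  by rewrite ge_min lerDl D0.
rewrite ge_min; apply/orP; right; apply: bigmax_le => [|i _].
  by rewrite addr_ge0 //; exact: bigmax_ge_id.
rewrite -[y i](subrKC (z i)) lerD //; first exact: le_bigmax.
by apply: le_trans (ler_norm _) (le_bigmax _ (fun i => `|y i - z i|) i).
Qed.

(** A lower bound through the single coordinate at which the maximum is
    reached: this is why the lower deviation does not grow with the number of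
    coordinates. *)
Lemma crest_ge (y : I -> R) : (0 < #|I|)%N -> exists i, forall z : I -> R,
  crest y - (`|z i - y i| - (z i - y i)) / 2 <= crest z.
Proof.
move=> I0; have [i0 _] : exists i : I, i \in I by apply/card_gt0P.
have neg0 (x : R) : 0 <= (`|x| - x) / 2.
  by rewrite divr_ge0 // subr_ge0 ler_norm.
pose i := [arg max_(j > i0) y j]%O.
have imax j : y j <= y i by rewrite /i; case: arg_maxP => // j' _; apply.
exists i => z; case: (leP (y i) 0) => yi.
  have -> : crest y = 0.
    apply/eqP; rewrite eq_le; case/andP: (crest01 y) => -> _; rewrite andbT.
    rewrite /crest ge_min; apply/orP; right; apply: bigmax_le => // j _.
    exact: le_trans (imax j) yi.
  rewrite sub0r; apply: (@le_trans _ _ 0); first by rewrite oppr_le0.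
  by case/andP: (crest01 z).
have zi : y i - (`|z i - y i| - (z i - y i)) / 2 <= z i.
  by case: (ger0P (z i - y i)); lra.
rewrite lerBlDr /crest; apply: (@le_trans _ _ (Num.min 1 (y i))).
  rewrite le_min ge_min lexx /= ge_min; apply/orP; right.
  by apply: bigmax_le => [|j _]; [exact: ltW | exact: imax].
rewrite -lerBlDr le_min !lerBlDr; apply/andP; split.
  by rewrite ge_min lerDl neg0.
rewrite -lerBlDr; apply: (@le_trans _ _ (z i)); last exact: le_bigmax.
by apply: le_trans zi; rewrite lerB // ge_min lexx orbT.
Qed.

(** The upper deviation involves the maximum of all perturbations, the lower
    one only the negative part of a single centred perturbation, whose mean is
    half that of its absolute value. *)
Lemma crest_smoothing (T : finType) (w : T -> R) (s2 : R) (y : I -> R)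
    (D : I -> T -> R) : is_pmf w -> (0 < #|I|)%N -> 0 < s2 ->
  (forall i, subgaussian w s2 (D i)) ->
  - (Num.sqrt (s2 * (2 * ln 2)) / 2)
    <= mean w (fun t => crest (fun i => y i + D i t)) - crest y
    <= Num.sqrt (s2 * (2 * ln (2 * #|I|%:R))).
Proof.
move=> wP I0 s0 sD; apply/andP; split.
  have [i yi] := crest_ge y I0.
  rewrite lerBrDl -lerBrDr opprK.
  apply: (@le_trans _ _ (mean w (fun t => crest y - (`|D i t| - D i t) / 2) +
      Num.sqrt (s2 * (2 * ln 2)) / 2)); last first.
    rewrite lerD2r; apply: le_mean => // t.
    by have := yi (fun i => y i + D i t); rewrite [_ + D i t - _]addrC addKr.
  rewrite meanB mean_cst // (eq_mean _ (G := fun t => 2^-1 * (`|D i t| - D i t)));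
    last by move=> t; rewrite mulrC.
  rewrite meanZ meanB (subgaussian_centered wP s0 (sD i)) subr0.
  by have := subgaussian_abs wP s0 (sD i); lra.
rewrite lerBlDl; apply: le_trans (lerD (lexx _) (subgaussian_max wP I0 s0 sD)).
rewrite -[X in X + _](mean_cst wP) -meanD; apply: le_mean => // t.
apply: le_trans (crest_lipschitz _ y) _; rewrite lerD2l.
by under eq_bigr do rewrite [_ + D _ t - _]addrC addKr.
Qed.

End Crest.

(** * Chaining over the noise level *)

Section Smoothing.
Variables (R : realType) (I L : finType).
Hypothesis I0 : (0 < #|I|)%N.

Definition score (a : I * L -> R) (x : L -> R) (i : I) : R :=
  \sum_l a (i, l) * x l.

Definition smooth_crest (p : nat) (m : I * L -> R) (x : L -> R) : R :=
  mean (@cloud_pmf R _ m p) (fun s => crest (score (average R s) x)).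

(** The width, in units of the standard deviation of the noise, of the interval
    given by [crest_smoothing]. *)
Definition smoothing_width : R :=
  Num.sqrt (2 * ln (2 * #|I|%:R)) + Num.sqrt (2 * ln 2) / 2.

Lemma score_mgf (T : finType) (w : T -> R) (p : nat) (d : T -> I * L -> R)
    (x : L -> R) (i : I) :
  (forall t, mean w (fun s => expR (\sum_j t j * d s j))
    <= expR ((\sum_j t j ^+ 2) / (2 * 2 ^+ p))) ->
  \sum_l x l ^+ 2 <= 1 ->
  subgaussian w (2 ^+ p)^-1 (fun s => score (d s) x i).
Proof.
move=> dmgf x1 l.
pose t (j : I * L) := if j.1 == i then l * x j.2 else 0.
have tE (f : I * L -> R) : (\sum_j (if j.1 == i then f j else 0)) = \sum_l f (i, l).
  transitivity (\sum_i' \sum_l (if i' == i then f (i', l) else 0)).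
    by rewrite pair_bigA; apply: eq_bigr => -[i' l'].
  rewrite (bigD1 i) //= eqxx [X in _ + X]big1 ?addr0 // => i' /negbTE ->.
  by rewrite big1.
rewrite (eq_mean _ (G := fun s => expR (\sum_j t j * d s j))); last first.
  move=> s; congr expR; rewrite /score mulr_sumr -[LHS](tE (fun j => l * (d s j * x j.2))).
  by apply: eq_bigr => j _; rewrite /t; case: eqP => _; rewrite ?mul0r //; ring.
apply: le_trans (dmgf t) _; rewrite ler_expR.
have -> : \sum_j t j ^+ 2 = l ^+ 2 * \sum_l x l ^+ 2.
  rewrite mulr_sumr -[RHS](tE (fun j => l ^+ 2 * x j.2 ^+ 2)).
  by apply: eq_bigr => j _; rewrite /t; case: eqP => _; rewrite ?expr0n // exprMn.
have e0 : 0 < 2 ^+ p :> R by rewrite exprn_gt0.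
rewrite [leLHS](_ : _ = l ^+ 2 * (2 ^+ p)^-1 / 2 * \sum_l x l ^+ 2); last first.
  by field; rewrite lt0r_neq0.
by rewrite -[leRHS]mulr1 ler_wpM2l // divr_ge0 // mulr_ge0 ?sqr_ge0 // invr_ge0 ltW.
Qed.

Lemma smoothing_interval (T : finType) (w : T -> R) (p : nat) (y : I -> R)
    (D : I -> T -> R) : is_pmf w ->
  (forall i, subgaussian w (2 ^+ p)^-1 (D i)) ->
  - (Num.sqrt (2 * ln 2) / 2 / Num.sqrt (2 ^+ p))
    <= mean w (fun t => crest (fun i => y i + D i t)) - crest y
    <= - (Num.sqrt (2 * ln 2) / 2 / Num.sqrt (2 ^+ p))
       + smoothing_width / Num.sqrt (2 ^+ p).
Proof.
move=> wP sD; have e0 : 0 < 2 ^+ p :> R by rewrite exprn_gt0.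
have v0 : 0 < (2 ^+ p)^-1 :> R by rewrite invr_gt0.
have := crest_smoothing y wP I0 v0 sD; rewrite /smoothing_width.
set A := 2 * ln (2 * _); set B : R := 2 * ln 2.
rewrite !(@sqrtrM _ (2 ^+ p)^-1) ?(ltW v0) // sqrtrV ?(ltW e0) // => /andP[e1 e2].
apply/andP; split; first by rewrite mulrAC [X in X / 2]mulrC.
by apply: le_trans e2 _; rewrite mulrDl addrCA addNr addr0 mulrC.
Qed.

Variables (V Q : finType) (p : V -> R) (u : V -> L -> R) (m : Q -> I * L -> R).
Hypothesis p_pmf : is_pmf p.
Hypothesis u1 : forall v, \sum_l u v l ^+ 2 <= 1.
Hypothesis m1 : forall q i, \sum_l m q (i, l) ^+ 2 <= 1.

Let m1_le q j : `|m q j| <= 1.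
Proof.
have : m q j ^+ 2 <= 1.
  case: j => i l; apply: le_trans (m1 q i); rewrite (bigD1 l) //= lerDl.
  by apply: sumr_ge0 => l' _; exact: sqr_ge0.
by rewrite -real_normK ?num_real // expr_le1.
Qed.

(** There are [2 ^ e] signs per coordinate, and each of the [#|I|] vectors of
    the parameter is in the unit ball. *)
Lemma chi2_le e q :
  \sum_s cloud_pmf (m q) s ^+ 2 / @fair R _ e s <= expR (2 ^+ e * #|I|%:R).
Proof.
apply: le_trans (chi2_cloud _ _) _; rewrite ler_expR ler_wpM2l ?exprn_ge0 //.
have -> : \sum_j m q j ^+ 2 = \sum_i \sum_l m q (i, l) ^+ 2.
  by rewrite pair_bigA; apply: eq_bigr => -[].
by rewrite -sum1_card natr_sum; exact: ler_sum.
Qed.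

Variable n : nat.
Hypothesis n0 : (0 < n)%N.
Variable q : seq V -> Q.

Let k : R := #|I|%:R.
Let k0 : 0 < k. Proof. by rewrite ltr0n. Qed.
Let n0R : 0 < n%:R :> R. Proof. by rewrite ltr0n. Qed.

(** At level 0 the functions of the signs take values in the unit interval. *)
Lemma chaining_base :
  Esample p n (fun s => dev p (fun v => smooth_crest 0 (m (q s)) (u v)) s)
    <= Num.sqrt (k / (2 * n%:R)).
Proof.
rewrite -[leRHS]mul1r; have := @pac_bayes_dev R V p p_pmf (cloud _ 0) Q (@fair R _ 0)
  (fun q => @cloud_pmf R _ (m q) 0) k 1 n
  (fun s v => crest (score (average R s) (u v))) (fun=> 0) q n0 k0 ltr01 (fairP _ _ _)
  (@fair_gt0 _ _ _) (fun q => cloud_pmfP 0 (m1_le q)); apply.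
- by move=> i; have := chi2_le 0 i; rewrite mul1r.
- by move=> t v; rewrite add0r crest01.
Qed.

(** Passing from clouds of size [2 ^ e] to clouds of size [2 ^ e.+1] costs the
    same at every level: the entropy doubles whereas the variance of the
    splicing noise is halved. *)
Lemma chaining_step e :
  Esample p n (fun s => dev p (fun v =>
    smooth_crest e.+1 (m (q s)) (u v) - smooth_crest e (m (q s)) (u v)) s)
    <= smoothing_width * Num.sqrt (k / n%:R).
Proof.
have e0 : 0 < 2 ^+ e :> R by rewrite exprn_gt0.
pose h (x : cloud _ e.+1) v := crest (score (average R x) (u v)) -
  mean (@fair R _ e) (fun t => crest (score (average R (splice t x.1 x.2)) (u v))).
have hE i v : smooth_crest e.+1 (m i) (u v) - smooth_crest e (m i) (u v) =
    mean (@cloud_pmf R _ (m i) e.+1) (fun x => h x v).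
  rewrite meanB /smooth_crest; congr (_ - _).
  rewrite exchange_mean -[LHS](mean_cst (fairP R (I * L)%type e)); apply: eq_mean => t.
  rewrite mean_pair -(splice_law t _ (m1_le i)); apply: eq_mean => a.
  by apply: eq_mean => b.
rewrite (eq_Esample p_pmf (G := fun s => dev p (fun v =>
  mean (@cloud_pmf R _ (m (q s)) e.+1) (fun x => h x v)) s)); last first.
  by move=> s _; apply: eq_dev => v; exact: hE.
(* [h] is the opposite of the smoothing error, hence lies above [b - r] *)
pose b := Num.sqrt (2 * ln 2) / 2 / Num.sqrt (2 ^+ e) : R.
pose r := smoothing_width / Num.sqrt (2 ^+ e).
have w0 : 0 < smoothing_width.
  rewrite addr_gt0 // ?divr_gt0 // sqrtr_gt0 mulr_gt0 // ln_gt0 ?ltr1n //.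
  have : 1 <= k by rewrite ler1n.
  by rewrite /k; lra.
have r0 : 0 < r by rewrite divr_gt0 // sqrtr_gt0.
have K0 : 0 < 2 ^+ e.+1 * k by rewrite mulr_gt0 // exprn_gt0.
have := @pac_bayes_dev R V p p_pmf (cloud _ e.+1) Q (@fair R _ e.+1)
  (fun q => @cloud_pmf R _ (m q) e.+1) (2 ^+ e.+1 * k) r n h (fun=> b - r) q n0 K0 r0
  (fairP _ _ _) (@fair_gt0 _ _ _) (fun q => cloud_pmfP e.+1 (m1_le q)) (chi2_le e.+1).
have -> : r * Num.sqrt (2 ^+ e.+1 * k / (2 * n%:R)) = smoothing_width * Num.sqrt (k / n%:R).
  have -> : 2 ^+ e.+1 * k / (2 * n%:R) = 2 ^+ e * (k / n%:R).
    by rewrite exprS; field; rewrite lt0r_neq0.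
  by rewrite sqrtrM ?(ltW e0) // /r mulrA mulfVK // lt0r_neq0 // sqrtr_gt0.
apply=> -[x1 x2] v; rewrite subrK.
pose D i t := score (fun j => average R (splice t x1 x2) j -
  (average R x1 j + average R x2 j) / 2) (u v) i.
have sD i : subgaussian (@fair R _ e) (2 ^+ e)^-1 (D i).
  exact: score_mgf (mgf_splice x1 x2) (u1 v).
have := smoothing_interval (score (fun j => (average R x1 j + average R x2 j) / 2) (u v))
  (fairP R _ e) sD.
rewrite -/b -/r /h (eq_mean _ (G := fun t => crest (score (average R (splice t x1 x2)) (u v)))).
  by move=> /andP[? ?]; apply/andP; split => /=; lra.
move=> t; congr crest; apply/funext => i; rewrite /D /score -big_split /=.
by apply: eq_bigr => l _; rewrite -mulrDl addrC subrK.
Qed.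

(** A function with values in an interval has a deviation at most the length
    of that interval, for any sample; no chaining is needed for the remainder. *)
Lemma chaining_bias e i s : (0 < size s)%N ->
  dev p (fun v => crest (score (m i) (u v)) - smooth_crest e (m i) (u v)) s
    <= smoothing_width / Num.sqrt (2 ^+ e).
Proof.
move=> s0; set r := _ / _.
pose b := Num.sqrt (2 * ln 2) / 2 / Num.sqrt (2 ^+ e) : R.
rewrite [leRHS](_ : _ = b - (b - r)); last by ring.
apply: dev_le => // v.
pose D j (t : cloud _ e) := score (fun j => average R t j - m i j) (u v) j.
have sD j : subgaussian (@cloud_pmf R _ (m i) e) (2 ^+ e)^-1 (D j).
  exact: score_mgf (fun t => mgf_average e t (m1_le i)) (u1 v).
have := smoothing_interval (score (m i) (u v)) (cloud_pmfP e (m1_le i)) sD.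
rewrite -/b -/r (eq_mean _ (G := fun t => crest (score (average R t) (u v)))).
  by rewrite -/(smooth_crest e (m i) (u v)) => /andP[? ?]; apply/andP; split; lra.
move=> t; congr crest; apply/funext => j; rewrite /D /score -big_split /=.
by apply: eq_bigr => l _; rewrite -mulrDl addrC subrK.
Qed.

(** Telescoping from level 0 to level [e], then to the parameter itself. *)
Theorem chaining e :
  Esample p n (fun s => dev p (fun v => crest (score (m (q s)) (u v))) s)
    <= Num.sqrt (k / (2 * n%:R)) + e%:R * (smoothing_width * Num.sqrt (k / n%:R))
       + smoothing_width / Num.sqrt (2 ^+ e).
Proof.
have main : Esample p n (fun s => dev p (fun v => smooth_crest e (m (q s)) (u v)) s)
    <= Num.sqrt (k / (2 * n%:R)) + e%:R * (smoothing_width * Num.sqrt (k / n%:R)).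
  elim: e => [|e IH]; first by rewrite mul0r addr0 chaining_base.
  rewrite -[e.+1%:R]natr1 (mulrDl e%:R 1) (mul1r (smoothing_width * _)) addrA.
  apply: le_trans (lerD IH (chaining_step e)); rewrite -EsampleD.
  apply: le_Esample => // s _; rewrite -devD le_eqVlt; apply/orP; left; apply/eqP.
  by apply: eq_dev => v; rewrite addrC subrK.
rewrite -[X in _ + X](Esample_cst p_pmf n).
apply: le_trans (lerD main (lexx _)); rewrite -EsampleD.
apply: le_Esample => // s sn.
have s0 : (0 < size s)%N by rewrite sn.
apply: le_trans (lerD (lexx _) (chaining_bias e (q s) s0)); rewrite -devD.
rewrite le_eqVlt; apply/orP; left; apply/eqP.
by apply: eq_dev => v; rewrite addrC subrK.
Qed.

End Smoothing.

(** * The numerical bound *)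

Section Numerics.
Variables (R : realType) (n k : nat).
Hypotheses (k2 : (2 <= k)%N) (kn : (2 * k <= n)%N).

Let K : R := k%:R.
Let N : R := n%:R.

(** Take for [e] the integer part of [log2 (n / k)].  The width is at most
    [sqrt (8 ln k)], which gives the first term of the bound; the bias is at
    most [4 sqrt (k ln k / n)], half of which is the second term, whereas the
    other half and the base level fit together in the third one. *)
Lemma chaining_le_bound : exists e : nat,
  Num.sqrt (K / (2 * N)) + e%:R * (smoothing_width R 'I_k * Num.sqrt (K / N))
    + smoothing_width R 'I_k / Num.sqrt (2 ^+ e) <= chaining_bound R n k.
Proof.
have k0 : (0 < k)%N by exact: leq_trans k2.
have K0 : 0 < K by rewrite ltr0n.
have K2 : 2 <= K by rewrite ler_nat.
have N0 : 0 < N by rewrite ltr0n; apply: leq_trans kn; rewrite muln_gt0.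
have ln20 : 0 < ln 2 :> R by rewrite ln_gt0 // ltr1n.
have lnK2 : ln 2 <= ln K by rewrite ler_ln ?posrE.
set L := ln K in lnK2 *; have L0 : 0 < L by exact: lt_le_trans lnK2.
have W : smoothing_width R 'I_k <= Num.sqrt (8 * L).
  pose x := Num.sqrt (2 * L).
  have x0 : 0 <= x by exact: sqrtr_ge0.
  have x2 : x ^+ 2 = 2 * L by rewrite sqr_sqrtr // mulr_ge0 // ltW.
  have -> : Num.sqrt (8 * L) = 2 * x.
    by rewrite -[2 * x]ger0_norm ?mulr_ge0 // -sqrtr_sqr exprMn x2; congr Num.sqrt; ring.
  have h1 : Num.sqrt (2 * ln 2) <= x by rewrite ler_wsqrtr // ler_pM2l.
  (* 4 ln k <= (3/2) ^ 2 (2 ln k), as ln (2 k) <= 2 ln k *)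
  have h2 : Num.sqrt (2 * ln (2 * #|'I_k|%:R)) <= 3 / 2 * x.
    rewrite card_ord lnM ?posrE // -/K -/L -[leRHS]ger0_norm ?mulr_ge0 //.
    rewrite -sqrtr_sqr ler_wsqrtr // exprMn x2; lra.
  rewrite /smoothing_width; lra.
have W0 : 0 <= smoothing_width R 'I_k by rewrite addr_ge0 ?divr_ge0 ?sqrtr_ge0.
pose e := trunc_log 2 (n %/ k).
have nk : (1 <= n %/ k)%N by rewrite divn_gt0 // (leq_trans _ kn) // mul2n -addnn leq_addr.
have e1 : (2 ^ e <= n %/ k)%N by exact: trunc_logP.
have e2 : (n %/ k < 2 ^ e.+1)%N by exact: trunc_log_ltn.
have E0 : 0 < 2 ^+ e :> R by rewrite exprn_gt0.
have E1 : 2 ^+ e <= N / K.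
  rewrite ler_pdivlMr // -natrX -natrM ler_nat.
  by apply: leq_trans (leq_trunc_div n k); rewrite leq_mul2r e1 orbT.
have E2 : N / (2 * K) <= 2 ^+ e.
  rewrite ler_pdivrMr ?mulr_gt0 // mulrA -exprSr -natrX -natrM ler_nat.
  by rewrite ltnW // -ltn_divLR.
have P : e%:R <= ln (N / K) / ln 2.
  rewrite ler_pdivlMr // mulr_natl -lnXn // ler_ln ?posrE //; exact: lt_le_trans E1.
exists e.
pose y := Num.sqrt (K * L / N).
have y0 : 0 <= y by exact: sqrtr_ge0.
have y2 : y ^+ 2 = K * L / N by rewrite sqr_sqrtr // divr_ge0 ?mulr_ge0 ?ltW.
have S1 : e%:R * (smoothing_width R 'I_k * Num.sqrt (K / N)) <=
    ln (N / K) / ln 2 * Num.sqrt (8 * K * L / N).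
  apply: ler_pM => //; first by rewrite mulr_ge0 ?sqrtr_ge0.
  have -> : 8 * K * L / N = 8 * L * (K / N) by ring.
  by rewrite (@sqrtrM _ (8 * L)) ?mulr_ge0 ?(ltW L0) // ler_wpM2r ?sqrtr_ge0.
have S2 : smoothing_width R 'I_k / Num.sqrt (2 ^+ e) <= 4 * y.
  rewrite ler_pdivrMr ?sqrtr_gt0 //; apply: (le_trans W).
  rewrite -(@ler_pXn2r _ 2) ?nnegrE ?mulr_ge0 ?sqrtr_ge0 //.
  rewrite !exprMn y2 !sqr_sqrtr ?mulr_ge0 ?(ltW L0) ?(ltW E0) //.
  have -> : 8 * L = 4 ^+ 2 * (K * L / N) * (N / (2 * K)).
    by field; rewrite !lt0r_neq0.
  by rewrite ler_wpM2l // mulr_ge0 // divr_ge0 ?mulr_ge0 ?ltW.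
have S3 : Num.sqrt (K / (2 * N)) + 2 * y <=
    Num.sqrt ((Num.sqrt 2 + 1) * K * (3 + 2 * L) / N).
  set c := Num.sqrt (K / (2 * N)).
  have c2 : c ^+ 2 = K / N / 2.
    by rewrite sqr_sqrtr ?divr_ge0 ?mulr_ge0 ?ltW //; field; rewrite lt0r_neq0.
  have c0 : 0 <= c by exact: sqrtr_ge0.
  rewrite -[leLHS]ger0_norm ?addr_ge0 ?mulr_ge0 // -sqrtr_sqr ler_wsqrtr //.
  have r2 : 7 / 5 <= Num.sqrt 2 :> R.
    rewrite -[leLHS]ger0_norm ?divr_ge0 // -sqrtr_sqr ler_wsqrtr //.
    by rewrite expr_div_n ler_pdivrMr ?exprn_gt0 // -!natrX -natrM ler_nat.
  set x := K / N in c2; have x0 : 0 <= x by rewrite divr_ge0 ?ltW.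
  have y2' : y ^+ 2 = L * x by rewrite y2 /x; ring.
  have -> : (Num.sqrt 2 + 1) * K * (3 + 2 * L) / N = (Num.sqrt 2 + 1) * ((3 + 2 * L) * x).
    by rewrite /x; ring.
  apply: (@le_trans _ _ (12 / 5 * ((3 + 2 * L) * x))); last first.
    apply: ler_wpM2r; last by lra.
    by apply: mulr_ge0 => //; rewrite addr_ge0 // mulr_ge0 // ltW.
    (* 4 c y <= (4 / 5) y ^ 2 + 5 c ^ 2 absorbs the double product *)
  have := sqr_ge0 (2 * y - 5 * c).
  have -> : 12 / 5 * ((3 + 2 * L) * x) = 36 / 5 * x + 24 / 5 * y ^+ 2 by rewrite y2'; field.
  have xc : x = 2 * c ^+ 2 by rewrite c2; field.
  rewrite xc; nra.
rewrite /chaining_bound -/K -/N -/L -/y.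
move: S1 S2 S3; move: (e%:R * _) (ln _ / _ * _) (_ / Num.sqrt (2 ^+ e)).
move: (Num.sqrt (K / (2 * N))) (Num.sqrt (_ * K * _ / N)) => a1 a2 a3 a4 a5.
move: {y0 y2} y => b; clear; lra.
Qed.

End Numerics.

(** * Finite-dimensional models of the Gaussian kernel *)

(** Gram-Schmidt: the component of every vector along the first vector of the
    list gives one coordinate, and the induction hypothesis, applied to what is
    left of the vectors after subtracting this component, gives the others.  A
    first vector equal to zero yields a null coordinate. *)
Lemma gram_coordinates (R : realType) (H : lmodType R) (dotp : {dot H for @idfun R})
    (I : eqType) (y : I -> H) (s : seq I) :
  exists (N : nat) (a : I -> 'I_N -> R), {in s &, forall i j,
    dotp (y i) (y j) = \sum_l a i l * a j l}.
Proof.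
have dotC (u v : H) : dotp u v = dotp v u by rewrite hermC expr0 mul1r.
have dotBl (u v w : H) : dotp (u - v) w = dotp u w - dotp v w by exact: linearBl.
have dotZl (e : R) (u v : H) : dotp (e *: u) v = e * dotp u v by exact: linearZl_LR.
have dotBr (u v w : H) : dotp w (u - v) = dotp w u - dotp w v by rewrite dotC dotBl !(dotC w).
have dotZr (e : R) (u v : H) : dotp v (e *: u) = e * dotp v u by rewrite dotC dotZl dotC.
elim: s y => [|i0 s IH] y; first by exists 0, (fun _ _ => 0).
pose g := dotp (y i0) (y i0).
have g_ge0 : 0 <= g.
  rewrite /g; have [->|y0] := eqVneq (y i0) 0; first by rewrite linear0l.
  exact/ltW/neq0_dnorm_gt0.
have g0 i : g = 0 -> dotp (y i) (y i0) = 0.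
  have [->|y0] := eqVneq (y i0) 0; first by rewrite linear0r.
  by have := neq0_dnorm_gt0 _ y0 : 0 < g; move=> /lt0r_neq0/eqP.
pose c i := dotp (y i) (y i0) / g.
have [N [a aE]] := IH (fun i => y i - c i *: y i0).
have zE i j : dotp (y i - c i *: y i0) (y j - c j *: y i0) =
    dotp (y i) (y j) - dotp (y i) (y i0) * dotp (y j) (y i0) / g.
  rewrite !(dotBl, dotBr) !(dotZl, dotZr) /c.
  rewrite (dotC (y i0) (y j)) -/g.
  have [/[dup] gg /g0 di|gn] := eqVneq g 0; first by rewrite !di; ring.
  by field.
exists N.+1, (fun i l => if unlift ord0 l is Some l' then
  if i == i0 then 0 else a i l' else dotp (y i) (y i0) / Num.sqrt g) => i j si sj.
rewrite big_ord_recl unlift_none.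
under eq_bigr do rewrite liftK.
have sg : Num.sqrt g * Num.sqrt g = g by rewrite -expr2 sqr_sqrtr.
have first_term : dotp (y i) (y i0) / Num.sqrt g * (dotp (y j) (y i0) / Num.sqrt g)
    = dotp (y i) (y i0) * dotp (y j) (y i0) / g.
  by rewrite mulrACA -invfM sg.
rewrite first_term; move: si sj; rewrite !inE.
have [-> _|ni /= si] := eqVneq i i0.
  rewrite big1 ?addr0; last by move=> l _; rewrite mul0r.
  move=> _; rewrite -/g dotC; have [/[dup] gg /g0 ->|gn] := eqVneq g 0.
    by rewrite mulr0 mul0r.
  by rewrite mulrAC divff ?mul1r.
have [-> _|nj /= sj] := eqVneq j i0.
  rewrite big1 ?addr0; last by move=> l _; rewrite mulr0.
  rewrite -/g; have [/[dup] gg /g0 ->|gn] := eqVneq g 0; first by rewrite !mul0r.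
  by rewrite mulfK.
by rewrite -aE // zE subrKC.
Qed.

(** Squeezed between [exp (x - 2 x ^ 2 / D)] and [exp x]. *)
Lemma cvg_exp_compound (R : realType) (x : R) :
  (fun D : nat => (1 + x / D%:R) ^+ D) @ \oo --> expR x.
Proof.
apply: (@squeeze_cvgr _ _ _ _ (fun D : nat => expR (x - 2 * x ^+ 2 / D%:R)) (fun=> expR x)).
- near=> D.
  have D0 : (0 < D)%N by near: D; exact: nbhs_infty_gt.
  have D0R : 0 < D%:R :> R by rewrite ltr0n.
  have xD : 2 * `|x| <= D%:R by near: D; exact: nbhs_infty_ger.
  set t := x / D%:R.
  have t2 : `|t| <= 2^-1.
    by rewrite /t normrM normfV (gtr0_norm D0R) ler_pdivrMr // mulrC; lra.
  have /andP[t2a t2b] : - 2^-1 <= t <= 2^-1 by rewrite -ler_norml.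
  have t1 : 0 < 1 + t by lra.
  have -> : x = t * D%:R by rewrite divfK // lt0r_neq0.
  apply/andP; split; last first.
    rewrite expRM_natr lerXn2r ?nnegrE ?expR_ge0 ?(ltW t1) //.
    exact: expR_ge1Dx.
  have -> : t * D%:R - 2 * (t * D%:R) ^+ 2 / D%:R = (t - 2 * t ^+ 2) * D%:R.
    by field; rewrite lt0r_neq0.
  rewrite expRM_natr lerXn2r ?nnegrE ?expR_ge0 ?(ltW t1) //.
  apply: (@le_trans _ _ (expR (t / (1 + t)))).
    rewrite ler_expR ler_pdivlMr // -subr_ge0.
    rewrite (_ : _ - _ = t ^+ 2 * (1 + 2 * t)); last by ring.
    by rewrite mulr_ge0 ?sqr_ge0 //; lra.
  rewrite -[leRHS]invrK -[leLHS]invrK lef_pV2 ?posrE ?invr_gt0 ?expR_gt0 //.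
  rewrite -expRN; apply: le_trans (expR_ge1Dx _).
  by rewrite le_eqVlt; apply/orP; left; apply/eqP; field; rewrite lt0r_neq0.
- have : (fun D : nat => x - 2 * x ^+ 2 / D%:R) @ \oo --> x.
    rewrite -[X in _ --> X]subr0; apply: cvgB; first exact: cvg_cst.
    rewrite -(mulr0 (2 * x ^+ 2)); apply: cvgM; first exact: cvg_cst.
    by rewrite -cvg_shiftS; exact: cvg_harmonic.
  by move/(continuous_cvg _ (@continuous_expR R x)); apply.
- exact: cvg_cst.
Unshelve. all: by end_near. Qed.

Definition gauss (R : realType) (H : normedModType R) (sigma : R) (x y : H) : R :=
  expR (- ((2 * sigma ^+ 2)^-1 * `|x - y| ^+ 2)).

(** Unit vectors [u i] whose inner products are close to the values of the
    kernel.  With [t = <y_i, y_j> / sigma ^ 2], the tensor power of order [D] of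
    the vectors [(1, y_i / (sigma sqrt D))] has inner products [(1 + t / D) ^ D],
    which tend to [exp t]; normalizing turns this exponential kernel into the
    Gaussian one. *)
Lemma gauss_features (R : realType) (H : completeNormedModType R)
    (dotp : {dot H for @idfun R}) (I : finType) (y : I -> H) (sigma eta : R) :
  induces_norm dotp -> 0 < sigma -> 0 < eta ->
  exists (L : finType) (u : I -> L -> R),
    (forall i, \sum_l u i l ^+ 2 = 1) /\
    (forall i j, `|\sum_l u i l * u j l - gauss sigma (y i) (y j)| <= eta).
Proof.
move=> dotn s0 eta0; have s20 : 0 < sigma ^+ 2 by rewrite exprn_gt0.
have [N [a aE]] := gram_coordinates dotp y (enum I).
pose x i j := dotp (y i) (y j) / sigma ^+ 2.
have x_ge0 i : 0 <= x i i by rewrite /x -dotn divr_ge0 // sqr_ge0.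
pose F D i j : R := (1 + x i j / D%:R) ^+ D.
have F_gt0 D i : 0 < F D i i.
  by rewrite exprn_gt0 // ltr_pwDl // divr_ge0.
pose b D i (o : 'I_N.+1) : R :=
  if unlift ord0 o is Some l then a i l / Num.sqrt (sigma ^+ 2 * D%:R) else 1.
have bE D i j : \sum_o b D i o * b D j o = 1 + x i j / D%:R.
  rewrite big_ord_recl /b unlift_none mulr1; congr (_ + _).
  have sD : Num.sqrt (sigma ^+ 2 * D%:R) * Num.sqrt (sigma ^+ 2 * D%:R) = sigma ^+ 2 * D%:R.
    by rewrite -expr2 sqr_sqrtr // mulr_ge0 // ltW.
  rewrite (eq_bigr (fun l => a i l * a j l / (sigma ^+ 2 * D%:R))); last first.
    by move=> l _; rewrite !liftK mulrACA -invfM sD.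
  by rewrite -mulr_suml -aE ?mem_enum // /x invfM mulrA.
pose f D i (w : {ffun 'I_D -> 'I_N.+1}) := \prod_t b D i (w t).
have fE D i j : \sum_w f D i w * f D j w = F D i j.
  rewrite /F -bE -[D in X in _ = _ ^+ X]card_ord -prodr_const.
  rewrite (bigA_distr_bigA (fun (_ : 'I_D) o => b D i o * b D j o)).
  by apply: eq_bigr => w _; rewrite big_split.
have lim i j : (fun D => F D i j / (Num.sqrt (F D i i) * Num.sqrt (F D j j))) @ \oo
    --> gauss sigma (y i) (y j).
  have -> : gauss sigma (y i) (y j) = expR (x i j) /
      (Num.sqrt (expR (x i i)) * Num.sqrt (expR (x j j))).
    have sE z : Num.sqrt (expR z) = expR (z / 2) :> R.
      rewrite -[RHS]ger0_norm ?expR_ge0 // -sqrtr_sqr -expRM_natr.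
      by rewrite divfK ?pnatr_eq0.
    rewrite !sE -expRD -expRB /gauss dotn hnormB expr0 mul1r /x; congr expR.
    rewrite /=; set A := dotp _ _; set B := dotp (y j) _; set C := dotp _ _.
    by field; rewrite lt0r_neq0.
  apply: cvgM; first exact: cvg_exp_compound.
  apply: cvgV; first by rewrite mulf_neq0 // lt0r_neq0 // sqrtr_gt0 expR_gt0.
  by apply: cvgM; apply: (continuous_cvg _ (@sqrt_continuous _ _)); exact: cvg_exp_compound.
have /filter_forall : forall ij : I * I, \forall D \near \oo,
    `|F D ij.1 ij.2 / (Num.sqrt (F D ij.1 ij.1) * Num.sqrt (F D ij.2 ij.2))
      - gauss sigma (y ij.1) (y ij.2)| <= eta.
  move=> [i j] /=; have /cvgrPdist_le/(_ _ eta0) := lim i j.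
  by apply: filterS => D; rewrite distrC.
move=> [D _ /(_ D (leqnn D)) DE].
exists {ffun 'I_D -> 'I_N.+1}, (fun i w => f D i w / Num.sqrt (F D i i)); split.
  move=> i; under eq_bigr do rewrite expr_div_n sqr_sqrtr ?(ltW (F_gt0 _ _)) // expr2.
  by rewrite -mulr_suml fE divff // lt0r_neq0.
move=> i j; under eq_bigr do rewrite mulrACA -invfM.
by rewrite -mulr_suml fE; exact: (DE (i, j)).
Qed.

(** * The Gaussian criterion over a finite space *)

Definition fit (R : realType) (H : normedModType R) (sigma : R) (k : nat)
    (c : 'I_k -> H) (x : H) : R :=
  \big[Num.max/0]_(j < k) gauss sigma x (c j).

Lemma robust_lossE (R : realType) (H : completeNormedModType R) (sigma : R)
    (k : nat) (c : 'I_k -> H) (x : H) : (0 < k)%N ->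
  robust_loss sigma c x = 1 - fit sigma c x.
Proof.
move=> k0; have [[j cj] cmin] := min_sqdistP c x k0.
rewrite /robust_loss /fit /gauss; congr (1 - _); apply/eqP; rewrite eq_le.
apply/andP; split; first by rewrite cj; apply: le_bigmax.
apply: bigmax_le => [|i _]; first exact: expR_ge0.
by rewrite ler_expR lerN2 ler_wpM2l // invr_ge0 mulr_ge0 // sqr_ge0.
Qed.

Lemma gauss01 (R : realType) (H : normedModType R) (sigma : R) (x y : H) :
  0 <= gauss sigma x y <= 1.
Proof.
rewrite expR_ge0 /= -expR0 ler_expR oppr_le0 mulr_ge0 ?sqr_ge0 //.
by rewrite invr_ge0 mulr_ge0 // sqr_ge0.
Qed.

Lemma fit01 (R : realType) (H : normedModType R) (sigma : R) (k : nat)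
    (c : 'I_k -> H) (x : H) : 0 <= fit sigma c x <= 1.
Proof.
rewrite bigmax_ge_id /=; apply: bigmax_le => // j _.
by case/andP: (gauss01 sigma x (c j)).
Qed.

(** The features are those of the finite family made of the points and of all
    the codevectors.  By the Lipschitz property of [crest], the error on the
    kernel is an error on the criterion. *)
Lemma chaining_fit (R : realType) (H : completeNormedModType R)
    (dotp : {dot H for @idfun R}) (V Q : finType) (p : V -> R) (x : V -> H)
    (n k : nat) (sigma : R) (c : Q -> 'I_k -> H) (q : seq V -> Q) :
  induces_norm dotp -> 0 < sigma -> (2 <= k)%N -> (2 * k <= n)%N -> is_pmf p ->
  Esample p n (fun s => dev p (fun v => fit sigma (c (q s)) (x v)) s)
    <= chaining_bound R n k.
Proof.
move=> dotn s0 k2 kn pP.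
have k0 : (0 < k)%N by exact: leq_trans k2.
have n0 : (0 < n)%N by apply: leq_trans kn; rewrite muln_gt0.
apply/ler_addgt0Pr => e e0; have e20 : 0 < e / 2 by rewrite divr_gt0.
pose y (i : V + Q * 'I_k) := match i with inl v => x v | inr qj => c qj.1 qj.2 end.
have [L [u [u1 uE]]] := gauss_features y dotn s0 e20.
pose m i (jl : 'I_k * L) := u (inr (i, jl.1)) jl.2.
pose z v := u (inl v).
have fitE i v : fit sigma (c i) (x v) = crest (fun j => gauss sigma (x v) (c i j)).
  by rewrite /crest /fit min_r //; case/andP: (fit01 sigma (c i) (x v)).
have close i v : `|fit sigma (c i) (x v) - crest (score (m i) (z v))| <= e / 2.
  have near (a b : 'I_k -> R) : (forall j, `|a j - b j| <= e / 2) ->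
      crest a - crest b <= e / 2.
    move=> ab; rewrite lerBlDl; apply: le_trans (crest_lipschitz a b) _.
    by rewrite lerD2l; apply: bigmax_le => [|j _]; [exact: ltW | exact: ab].
  have gs j : `|score (m i) (z v) j - gauss sigma (x v) (c i j)| <= e / 2.
    have := uE (inl v) (inr (i, j)); rewrite /= /score /m /z /=.
    by under eq_bigr do rewrite mulrC.
  rewrite fitE ler_norml lerNl opprB; apply/andP; split.
    by apply: near => j.
  by apply: near => j; rewrite distrC.
have [d dE] := chaining_le_bound R k2 kn.
have I0 : (0 < #|'I_k|)%N by rewrite card_ord.
have z1 v : \sum_l z v l ^+ 2 <= 1 by rewrite (u1 (inl v)).
have m1 i j : \sum_l m i (j, l) ^+ 2 <= 1 by rewrite (u1 (inr (i, j))).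
have := chaining I0 pP z1 m1 n0 q d; rewrite card_ord => /le_trans/(_ dE) main.
apply: le_trans (lerD main (lexx e)).
rewrite -[X in _ <= _ + X](Esample_cst pP n) -EsampleD; apply: le_Esample => // s sn.
have s_gt0 : (0 < size s)%N by rewrite sn.
rewrite -lerBlDl -(devN _ (fun v => crest _)) -devD.
rewrite [leRHS](_ : _ = e / 2 - (- (e / 2))); last by field.
by apply: dev_le => // v; rewrite -ler_norml.
Qed.

(** * Finite models of a random sample *)

Section FiniteValued.
Variables (R : realType) (d : measure_display) (T : measurableType d).
Variable P : probability T R.

Lemma bounded_integrable (f : T -> R) (a : R) : measurable_fun [set: T] f ->
  (forall x, `|f x| <= a) -> P.-integrable [set: T] (EFin \o f).
Proof.
move=> mf fa; apply: measurable_bounded_integrable => //.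
  by apply: (le_lt_trans (probability_le1 P measurableT)); rewrite ltry.
by exists a; split; [exact: num_real | move=> x ax t _; exact: le_trans (fa t) (ltW ax)].
Qed.

Lemma integrable_cst (a : R) : P.-integrable [set: T] (EFin \o (fun=> a)).
Proof. by apply: (@bounded_integrable _ `|a|) => //; exact: measurable_cst. Qed.

Lemma Rintegral_cst_prob (a : R) : \int[P]_x a = a.
Proof.
rewrite Rintegral_cst // -[RHS]mulr1; congr (_ * _).
by rewrite [X in fine X](probability_setT P).
Qed.

Variables (V : finType) (Z : T -> V).
Hypothesis mZ : forall v, measurable (Z @^-1` [set v]).

Let finite_valuedE (F : V -> R) :
  EFin \o (F \o Z) =
  (fun x => \sum_v ((F v)%:E * (\1_(Z @^-1` [set v]) x)%:E)%E).
Proof.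
apply/funext => x /=; rewrite (bigD1 (Z x)) //= big1 => [|v vZ].
  by rewrite indicE mem_set //= mule1 adde0.
rewrite indicE memNset ?mule0 //= => vE; by rewrite vE eqxx in vZ.
Qed.

Lemma finite_valued_integrable (F : V -> R) :
  P.-integrable [set: T] (EFin \o (F \o Z)).
Proof.
rewrite finite_valuedE; apply: integrable_sum => // v _.
by apply: integrableZl => //; exact: integrable_indic.
Qed.

Lemma finite_valued_measurable (F : V -> R) : measurable_fun [set: T] (F \o Z).
Proof. exact/measurable_EFinP/measurable_int/finite_valued_integrable. Qed.

Lemma Rintegral_finite_valued (F : V -> R) :
  \int[P]_x F (Z x) = mean (fun v => fine (P (Z @^-1` [set v]))) F.
Proof.
rewrite /Rintegral -[X in fine X]/(integral P setT (EFin \o (F \o Z))).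
rewrite finite_valuedE integral_sum //; last first.
  by move=> v; apply: integrableZl => //; exact: integrable_indic.
have intE v : (\int[P]_x ((F v)%:E * (\1_(Z @^-1` [set v]) x)%:E))%E =
    (F v * fine (P (Z @^-1` [set v])))%:E.
  rewrite integralZl //; last exact: integrable_indic.
  by rewrite integral_indic // setIT EFinM fineK // fin_num_measure.
under eq_bigr do rewrite intE.
by rewrite sumEFin /mean; apply: eq_bigr => v _; rewrite mulrC.
Qed.

Lemma finite_valued_pmf : is_pmf (fun v => fine (P (Z @^-1` [set v]))).
Proof.
split=> [v|]; first by rewrite fine_ge0.
have := Rintegral_finite_valued (fun=> 1); rewrite Rintegral_cst_prob.
by rewrite /mean; under eq_bigr do rewrite mulr1.
Qed.

End FiniteValued.

(** The cells are the joint level sets of the functions rounded down to the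
    multiples of [1 / N]. *)
Lemma quantization (R : realType) (d : measure_display) (T : measurableType d)
    (Q : finType) (g : Q -> T -> R) (eta : R) : 0 < eta ->
  (forall q, measurable_fun [set: T] (g q)) -> (forall q x, 0 <= g q x <= 1) ->
  exists (V : finType) (Y : T -> V), (forall v, measurable (Y @^-1` [set v])) /\
    (forall x x', Y x = Y x' -> forall q, `|g q x - g q x'| <= eta).
Proof.
move=> eta0 mg g01; pose N := (Num.truncn eta^-1).+1.
have N0 : 0 < N%:R :> R by rewrite ltr0n.
have Neta : N%:R^-1 <= eta.
  rewrite -[leRHS]invrK lef_pV2 ?posrE ?invr_gt0 //.
  by apply: ltW; exact: truncnS_gt.
have gN q x : 0 <= N%:R * g q x.
  by have /andP[g0 _] := g01 q x; rewrite mulr_ge0 // ltW.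
pose cell q x := Num.truncn (N%:R * g q x).
have cell_le q x : (cell q x < N.+1)%N.
  rewrite /cell truncn_lt_nat // -natr1 (@le_lt_trans _ _ N%:R) ?ltrDl //.
  by have /andP[_ g1] := g01 q x; rewrite -[leRHS]mulr1 ler_wpM2l // ltW.
exists {ffun Q -> 'I_N.+1}, (fun x => [ffun q => Ordinal (cell_le q x)]); split.
  move=> v; rewrite [X in measurable X](_ : _ = \bigcap_(q in [set: Q])
      ([set: T] `&` g q @^-1` `[(v q)%:R / N%:R, (v q).+1%:R / N%:R[%classic)); last first.
    apply/seteqP; split => [x /= <- q _ /=|x vx /=].
      split=> //; rewrite ffunE /= in_itv /= ler_pdivrMr // ltr_pdivlMr //.
      by rewrite mulrC; exact: truncn_itv.
    apply/ffunP => q; rewrite ffunE; apply/val_inj => /=.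
    have [_ /=] := vx q Logic.I; rewrite in_itv /= ler_pdivrMr // ltr_pdivlMr // mulrC.
    exact: truncn_def.
  apply: fin_bigcap_measurable; first exact: finite_finset.
  by move=> q _; apply: mg => //; exact: measurable_itv.
move=> x x' /ffunP xx' q; apply: le_trans Neta.
have := xx' q; rewrite !ffunE => /(congr1 val) /= c.
have /andP[a1 a2] := truncn_itv (gN q x); have /andP[b1 b2] := truncn_itv (gN q x').
rewrite -[Num.truncn _]/(cell q x) c in a1 a2; rewrite -[Num.truncn _]/(cell q x') in b1 b2.
rewrite -[leRHS]mul1r ler_pdivlMr // -[X in _ * X]ger0_norm ?(ltW N0) // -normrM.
rewrite -natr1 in a2 b2.
rewrite mulrC mulrBr ler_norml.
by apply/andP; split; lra.
Qed.

(** The form in which independence gives the law of a sample. *)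
Lemma Esample_ffun (R : realType) (V : finType) (p : V -> R) n (F : seq V -> R) :
  Esample p n F = \sum_(y : {ffun 'I_n -> V})
    (\prod_i p (y i)) * F [seq y i | i <- enum 'I_n].
Proof.
elim: n F => [|n IH] F /=.
  have Z (y z : {ffun 'I_0 -> V}) : y = z by apply/ffunP => -[].
  pose y0 : {ffun 'I_0 -> V} := ffun0 (card_ord 0).
  rewrite (bigD1 y0) //= [X in _ + X]big1 => [|y /negP[]]; last by rewrite (Z y y0).
  rewrite big_ord0 mul1r addr0; congr F; apply/esym/size0nil.
  by rewrite size_map size_enum_ord.
rewrite /mean; under [LHS]eq_bigr do rewrite IH mulr_sumr.
rewrite pair_bigA /=.
pose join (vy : V * {ffun 'I_n -> V}) : {ffun 'I_n.+1 -> V} :=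
  [ffun i => if unlift ord0 i is Some j then vy.2 j else vy.1].
pose cut (y : {ffun 'I_n.+1 -> V}) := (y ord0, [ffun j => y (lift ord0 j)]).
rewrite [RHS](reindex join) /=; last first.
  exists cut => [[v y] _|y _]; rewrite /cut /join /=.
    rewrite !ffunE unlift_none; congr pair.
    by apply/ffunP => j; rewrite !ffunE liftK.
  apply/ffunP => i; rewrite !ffunE.
  by case: unliftP => [j|] ->; rewrite ?ffunE.
apply: eq_bigr => -[v y] _; rewrite big_ord_recl /join /= ffunE unlift_none mulrA.
congr (_ * _ * _); first by apply: eq_bigr => i _; rewrite ffunE liftK.
congr F; rewrite enum_ordSl /= ffunE unlift_none; congr cons.
by rewrite -map_comp; apply: eq_map => i /=; rewrite ffunE liftK.
Qed.

Section Rintegrals.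
Variables (R : realType) (d : measure_display) (T : measurableType d).
Variable P : probability T R.

Lemma le_Rintegral_bounded (f g : T -> R) (a b : R) :
  measurable_fun [set: T] f -> measurable_fun [set: T] g ->
  (forall x, `|f x| <= a) -> (forall x, `|g x| <= b) ->
  (forall x, f x <= g x) -> \int[P]_x f x <= \int[P]_x g x.
Proof.
move=> mf mg fa gb fg; apply: le_Rintegral => //.
- exact: bounded_integrable fa.
- exact: bounded_integrable gb.
Qed.

Lemma Rintegral_close (f g : T -> R) (a b e : R) :
  measurable_fun [set: T] f -> measurable_fun [set: T] g ->
  (forall x, `|f x| <= a) -> (forall x, `|g x| <= b) ->
  (forall x, `|f x - g x| <= e) -> `|\int[P]_x f x - \int[P]_x g x| <= e.
Proof.
move=> mf mg fa gb fge.
have If := bounded_integrable P mf fa; have Ig := bounded_integrable P mg gb.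
have mfg : measurable_fun [set: T] (fun x => f x - g x) by exact: measurable_funB.
rewrite -RintegralB // ler_norml.
have me (a' : R) : measurable_fun [set: T] (fun=> a') by exact: measurable_cst.
have fgE x : - e <= f x - g x <= e by rewrite -ler_norml.
apply/andP; split.
  rewrite -[leLHS](Rintegral_cst_prob P).
  apply: (le_Rintegral_bounded (me _) mfg (fun=> lexx _) fge) => x.
  by case/andP: (fgE x).
rewrite -[leRHS](Rintegral_cst_prob P).
apply: (le_Rintegral_bounded mfg (me _) fge (fun=> lexx _)) => x.
by case/andP: (fgE x).
Qed.

End Rintegrals.

Lemma measurable_bigmax (R : realType) (d : measure_display) (T : measurableType d)
    (I : Type) (r : seq I) (f0 : T -> R) (f : I -> T -> R) :
  measurable_fun [set: T] f0 -> (forall i, measurable_fun [set: T] (f i)) ->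
  measurable_fun [set: T] (fun x => \big[Num.max/f0 x]_(i <- r) f i x).
Proof.
move=> mf0 mf; elim: r => [|i r IH]; first by under eq_fun do rewrite big_nil.
by under eq_fun do rewrite big_cons; exact: measurable_maxr.
Qed.

Section MeasurableFit.
Variables (R : realType) (H : completeNormedModType R) (sigma : R) (k : nat).

Lemma continuous_borel_measurable (f : H -> R) : continuous f ->
  measurable_fun [set: borel H] (f : borel H -> R).
Proof.
move=> /continuousP cf.
apply: (measurability _ (RGenOpens.measurableE R)) => _ [_ [a [b ->]] <-].
rewrite setTI; apply: sub_sigma_algebra; apply: cf; exact: interval_open.
Qed.

Lemma measurable_fit (c : 'I_k -> H) :
  measurable_fun [set: borel H] (fit sigma c : borel H -> R).
Proof.
rewrite /fit; have mg (y : H) : measurable_fun [set: borel H] (gauss sigma ^~ y : borel H -> R).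
  apply: continuous_borel_measurable => x; rewrite /gauss.
  apply: continuous_comp; last exact: continuous_expR.
  apply: cvgN; apply: cvgM; first exact: cvg_cst.
  apply: (@continuous_comp _ _ _ (fun x => `|x - y|) (fun r : R => r ^+ 2)); last exact: exprn_continuous.
  apply: (@continuous_comp _ _ _ (fun x => x - y) Num.norm); last exact: norm_continuous.
  by apply: cvgB; [exact: cvg_id | exact: cvg_cst].
by apply: measurable_bigmax => [|j]; [exact: measurable_cst | exact: mg].
Qed.

End MeasurableFit.

(** * The deviation process *)

Section FiniteModel.
Variables (R : realType) (H : completeNormedModType R).
Variables (d0 : measure_display) (T0 : measurableType d0) (P0 : probability T0 R).
Variables (X : {RV P0 >-> borel H}) (n k : nat) (sigma : R).
Variables (d : measure_display) (T : measurableType d) (P : probability T R).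
Variable Xs : 'I_n -> {RV P >-> borel H}.
Hypothesis Hindep : mutually_independent Xs.
Hypothesis Hcopies : forall i, identically_distributed (Xs i) X.
Hypothesis n0 : (0 < n)%N.

Let mu : probability (borel H) R := distribution P0 X.

Definition excess (c : 'I_k -> H) (w : T) : R :=
  n%:R^-1 * (\sum_(i < n) fit sigma c (Xs i w)) - \int[mu]_x fit sigma c x.

Lemma fit_norm (c : 'I_k -> H) (x : H) : `|fit sigma c x| <= 1.
Proof. by have /andP[? ?] := fit01 sigma c x; rewrite ger0_norm. Qed.

(** Replacing every point by a representative of its cell turns the sample into
    an independent sample of a law with finite support. *)
Lemma finite_model (Q : finType) (c : Q -> 'I_k -> H) (eta : R) : 0 < eta ->
  exists (V : finType) (p : V -> R) (x : V -> H) (S : T -> seq V),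
    [/\ is_pmf p, forall w, size (S w) = n,
        forall F : seq V -> R, measurable_fun [set: T] (fun w => F (S w)) /\
          P.-integrable [set: T] (EFin \o (fun w => F (S w))) /\
          \int[P]_w F (S w) = Esample p n F
      & forall w q,
          `|dev p (fun v => fit sigma (c q) (x v)) (S w) - excess (c q) w| <= 2 * eta].
Proof.
move=> eta0.
have [V [Y [mY Yeta]]] := quantization (g := fun q => fit sigma (c q) : borel H -> R)
  eta0 (fun q => measurable_fit sigma (c q)) (fun q => fit01 sigma (c q)).
pose p v := fine (mu (Y @^-1` [set v])).
pose x v : H := xget 0 (Y @^-1` [set v]).
have Yx z : Y (x (Y z)) = Y z by have := @xgetI _ 0 (Y @^-1` [set Y z]) z erefl.
pose S w := [seq Y (Xs i w) | i <- enum 'I_n].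
pose Z w : {ffun 'I_n -> V} := [ffun i => Y (Xs i w)].
have SZ w : S w = [seq Z w i | i <- enum 'I_n].
  by apply: eq_map => i; rewrite ffunE.
have ZE y : Z @^-1` [set y] = \bigcap_i (Xs i @^-1` (Y @^-1` [set y i])).
  apply/seteqP; split => [w /= <- i _ /=|w wy]; first by rewrite ffunE.
  by apply/ffunP => i; rewrite ffunE; exact: (wy i I).
have mXY i v : measurable (Xs i @^-1` (Y @^-1` [set v])).
  by rewrite -[X in measurable X]setTI; exact: measurable_funPT.
have mZ y : measurable (Z @^-1` [set y]).
  by rewrite ZE; apply: fin_bigcap_measurable => //; exact: finite_finset.
have PZ y : fine (P (Z @^-1` [set y])) = \prod_i p (y i).
  rewrite ZE (Hindep (fun i => mY (y i))).
  rewrite (eq_bigr (fun i => (p (y i))%:E)); first by rewrite prodEFin.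
  move=> i _; rewrite /p fineK ?fin_num_measure //.
  exact: (Hcopies i (mY (y i))).
have pP : is_pmf p by exact: finite_valued_pmf.
exists V, p, x, S; split => //.
- by move=> w; rewrite size_map size_enum_ord.
- move=> F; pose F' (y : {ffun 'I_n -> V}) := F [seq y i | i <- enum 'I_n].
  have -> : (fun w => F (S w)) = F' \o Z by apply/funext => w; rewrite /= /F' SZ.
  split; first exact: finite_valued_measurable.
  split; first exact: finite_valued_integrable.
  rewrite (Rintegral_finite_valued _ mZ) Esample_ffun.
  by apply: eq_bigr => y _; rewrite PZ.
move=> w q; have close z : `|fit sigma (c q) (x (Y z)) - fit sigma (c q) z| <= eta.
  by apply: Yeta; exact: Yx.
rewrite /dev /excess size_map size_enum_ord big_map big_enum /=.
rewrite [X in `|X|](_ : _ =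
  n%:R^-1 * (\sum_(i < n) (fit sigma (c q) (x (Y (Xs i w))) - fit sigma (c q) (Xs i w)))
  - (mean p (fun v => fit sigma (c q) (x v)) - \int[mu]_z fit sigma (c q) z)); last first.
  by rewrite sumrB; ring.
apply: le_trans (ler_normB _ _) _; rewrite mulr2n mulrDl mul1r lerD //.
  rewrite normrM ger0_norm ?invr_ge0 // ler_pdivrMl ?ltr0n //.
  apply: le_trans (ler_norm_sum _ _ _) _.
  apply: (@le_trans _ _ (\sum_(i < n) eta)); first exact: ler_sum.
  by rewrite sumr_const card_ord mulr_natl.
rewrite /p -(Rintegral_finite_valued mu mY (fun v => fit sigma (c q) (x v))).
apply: (@Rintegral_close _ _ _ _ _ _ 1 1) => //.
- exact: (finite_valued_measurable mu mY (fun v => fit sigma (c q) (x v))).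
- exact: measurable_fit.
- by move=> z; exact: fit_norm.
- by move=> z; exact: fit_norm.
Qed.

End FiniteModel.

(** * A countable family of codebooks *)

(** For [a <= b <= a + 1/2], [e^(-a^2) - e^(-b^2) <= e^(-a^2) (b - a) (b + a)]
    and [b + a <= 2 e^(a^2)]; for larger [b] the bound is trivial. *)
Lemma exp_sqr_lipschitz (R : realType) (a b : R) : 0 <= a -> 0 <= b ->
  `|expR (- a ^+ 2) - expR (- b ^+ 2)| <= 2 * `|a - b|.
Proof.
wlog ab : a b / a <= b => [wh|] a0 b0.
  have [ab|/ltW ba] := leP a b; first exact: wh.
  by rewrite distrC [X in 2 * X]distrC; exact: wh.
have ea : 0 < expR (- a ^+ 2) by exact: expR_gt0.
have eb : 0 < expR (- b ^+ 2) by exact: expR_gt0.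
have a1 : expR (- a ^+ 2) <= 1 by rewrite -expR0 ler_expR oppr_le0 sqr_ge0.
have le_eba : expR (- b ^+ 2) <= expR (- a ^+ 2).
  by rewrite ler_expR lerN2 lerXn2r ?nnegrE.
rewrite ger0_norm ?subr_ge0 // ler0_norm ?subr_le0 // opprB.
have [ab2|ab2] := leP (2^-1) (b - a); first by lra.
have -> : expR (- b ^+ 2) = expR (- a ^+ 2) * expR (- (b ^+ 2 - a ^+ 2)).
  by rewrite -expRD; congr expR; ring.
have h1 : 1 - expR (- (b ^+ 2 - a ^+ 2)) <= (b - a) * (b + a).
  by have := expR_ge1Dx (- (b ^+ 2 - a ^+ 2)); lra.
have h2 : expR (- a ^+ 2) * (b + a) <= 2.
  rewrite expRN ler_pdivrMl ?expR_gt0 //.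
  have := expR_ge1Dx (a ^+ 2); have := sqr_ge0 (a - 2^-1); lra.
have h3 := ler_wpM2l (ltW ea) h1.
have ba : 0 <= b - a by rewrite subr_ge0.
have := ler_wpM2l ba h2; lra.
Qed.

Lemma gauss_lipschitz (R : realType) (H : completeNormedModType R) (sigma : R)
    (x y z : H) : 0 < sigma ->
  `|gauss sigma x y - gauss sigma x z| <= 2 / sigma * `|y - z|.
Proof.
move=> s0; pose s := Num.sqrt (2 * sigma ^+ 2)^-1.
have s2 : s ^+ 2 = (2 * sigma ^+ 2)^-1.
  by rewrite sqr_sqrtr // invr_ge0 mulr_ge0 // sqr_ge0.
have s_ge0 : 0 <= s by exact: sqrtr_ge0.
have s_le : s <= sigma^-1.
  rewrite -(@ler_pXn2r _ 2) ?nnegrE ?invr_ge0 ?(ltW s0) // s2 exprVn.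
  by rewrite lef_pV2 ?posrE ?mulr_gt0 ?exprn_gt0 // ler_peMl ?sqr_ge0 // ler1n.
have gE (u : H) : gauss sigma x u = expR (- (s * `|x - u|) ^+ 2).
  by rewrite /gauss exprMn s2.
rewrite !gE; apply: le_trans (exp_sqr_lipschitz _ _) _; rewrite ?mulr_ge0 //.
rewrite -mulrBr normrM (ger0_norm s_ge0) -mulrA ler_pM2l //.
apply: ler_pM => //; apply: le_trans (ler_dist_dist _ _) _.
by rewrite opprB addrC addrA subrK distrC.
Qed.

(** The index 0 is reserved to a given codebook, so that every initial segment
    of the sequence contains the reference codebook of the comparisons. *)
Lemma fit_dense_sequence (R : realType) (H : completeNormedModType R)
    (k : nat) (sigma : R) (cstar : 'I_k -> H) : 0 < sigma -> separable H ->
  exists cc : nat -> 'I_k -> H, cc 0 = cstar /\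
    forall (c : 'I_k -> H) (e : R), 0 < e ->
      exists m, forall x, `|fit sigma c x - fit sigma (cc m) x| <= e.
Proof.
move=> s0 [S [/countable_injP[f finj] Sdense]].
pose s m : H := xget 0 (S `&` [set x | f x = m]).
have sf x : S x -> s (f x) = x.
  move=> Sx; rewrite /s; case: xgetP => [y _ [Sy fy]|/(_ x)[]//].
  by apply: finj => //; exact: mem_set.
exists (fun m => if m is m'.+1 then
  (if unpickle m' is Some q then fun j => s ((q : {ffun 'I_k -> nat}) j) else cstar)
  else cstar); split => // c e e0.
pose r := e / (2 / sigma).
have r0 : 0 < r by rewrite !divr_gt0.
have near j : {y | S y & `|c j - y| < r}.
  apply: cid2; have [||y [cy Sy]] := Sdense (ball (c j) r).
    - by exists (c j); exact: ballxx.
    - exact: ball_open.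
  by exists y => //; move: cy; rewrite -ball_normE.
pose q := [ffun j => f (s2val (near j))].
exists (pickle q).+1 => x; rewrite pickleK.
have close j : `|gauss sigma x (c j) - gauss sigma x (s (q j))| <= e.
  apply: le_trans (gauss_lipschitz x (c j) (s (q j)) s0) _.
  rewrite ffunE; case: (near j) => y Sy cy /=; rewrite sf //.
  by rewrite mulrC -ler_pdivlMr ?divr_gt0 // ltW.
have le_fit (g h : 'I_k -> R) : (forall j, 0 <= h j) ->
    (forall j, `|g j - h j| <= e) ->
    \big[Num.max/0]_j g j - \big[Num.max/0]_j h j <= e.
  move=> h0 gh; rewrite lerBlDl; apply: bigmax_le => [|j _].
    by rewrite addr_ge0 ?(ltW e0) //; exact: bigmax_ge_id.
  rewrite -[g j](subrKC (h j)) lerD ?le_bigmax //.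
  exact: le_trans (ler_norm _) (gh j).
rewrite ler_norml lerNl opprB /fit; apply/andP; split; apply: le_fit => j;
  rewrite ?expR_ge0 // distrC; exact: close.
Qed.

(** * Uniform deviations *)

Section Deviations.
Variables (R : realType) (H : completeNormedModType R).
Variables (dotp : {dot H for @idfun R}).
Hypothesis dotn : induces_norm dotp.
Variables (d0 : measure_display) (T0 : measurableType d0) (P0 : probability T0 R).
Variables (X : {RV P0 >-> borel H}) (n k : nat) (sigma : R).
Hypotheses (s0 : 0 < sigma) (k2 : (2 <= k)%N) (kn : (2 * k <= n)%N).
Variables (d : measure_display) (T : measurableType d) (P : probability T R).
Variable Xs : 'I_n -> {RV P >-> borel H}.
Hypothesis Hindep : mutually_independent Xs.
Hypothesis Hcopies : forall i, identically_distributed (Xs i) X.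

Let n0 : (0 < n)%N.
Proof. by apply: leq_trans kn; rewrite muln_gt0; exact: leq_trans k2. Qed.
Let n0R : 0 < n%:R :> R. Proof. by rewrite ltr0n. Qed.

Let B : R := chaining_bound R n k.
Let exc : ('I_k -> H) -> T -> R := excess X sigma Xs.

Lemma measurable_excess (c : 'I_k -> H) : measurable_fun [set: T] (exc c).
Proof.
apply: measurable_funB; last exact: measurable_cst.
apply: measurable_funM; first exact: measurable_cst.
apply: measurable_sum => i.
exact: (measurableT_comp (measurable_fit sigma c)).
Qed.

Lemma excess_norm (c : 'I_k -> H) w : `|exc c w| <= 2.
Proof.
rewrite /exc /excess (_ : 2 = 1 + 1) //; apply: le_trans (ler_normB _ _) _.
apply: lerD.
  rewrite normrM ger0_norm ?invr_ge0 // ler_pdivrMl // mulr1.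
  apply: le_trans (ler_norm_sum _ _ _) _.
  apply: (@le_trans _ _ (\sum_(i < n) 1)).
    by apply: ler_sum => i _; exact: fit_norm.
  by rewrite sumr_const card_ord.
have := @Rintegral_close _ _ _ (distribution P0 X) (fit sigma c) (fun=> 0) 1 0 1
  (measurable_fit sigma c) (@measurable_cst _ _ _ _ _ _) (fit_norm sigma c).
rewrite Rintegral_cst_prob subr0; apply => x; rewrite ?normr0 // subr0.
exact: fit_norm.
Qed.

Section Family.
Variables (Q : finType) (c : Q -> 'I_k -> H) (q0 : Q) (kap : R).
Hypothesis kap0 : 0 <= kap.

(** The largest deviation is the deviation at a codebook selected by the sample,
    to which [chaining_fit] applies.  The multiple [kap] of the deviation at a
    reference codebook that is subtracted will be 0 for the first statement of
    the theorem and 1 for the others. *)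
Lemma model_deviation (V : finType) (p : V -> R) (x : V -> H) : is_pmf p ->
  let D q := dev p (fun v => fit sigma (c q) (x v)) in
  exists F : seq V -> R,
    [/\ forall q s, D q s - kap * D q0 s <= F s,
        Esample p n F <= B
      & bounded_differences n ((1 + kap) / n%:R) F].
Proof.
move=> pP D; pose q s := [arg max_(q > q0) D q s]%O.
have qmax i s : D i s <= D (q s) s by rewrite /q; case: arg_maxP => // j _; apply.
exists (fun s => D (q s) s - kap * D q0 s); split.
- by move=> i s; rewrite lerB.
- rewrite (EsampleB pP) (EsampleZ p n kap (D q0)) (Esample_dev pP) // mulr0 subr0.
  exact: (chaining_fit _ _ _ dotn s0 k2 kn pP).
have bD i : bounded_differences n (1 / n%:R) (D i).
  by apply: (dev_bounded_differences p (a := 0)) => v; rewrite add0r; exact: fit01.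
move=> s1 v v' s2 sn; set s := _ ++ _ in sn *; set s' := _ ++ v' :: s2.
have sn' : size s' = n by rewrite -sn /s /s' !size_cat.
have h1 : D (q s) s - D (q s) s' <= 1 / n%:R by exact: bD.
have h2 : D q0 s' - D q0 s <= 1 / n%:R by exact: (bD q0 s1 v' v s2).
have h3 := ler_wpM2l kap0 h2; have h4 := qmax (q s) s'.
by rewrite mulrDl; lra.
Qed.

(** In a finite model of precision [eta] the bound holds with [t' < t] in place
    of [t], the difference paying for the quantization; then [t'] tends to
    [t]. *)
Lemma excess_tail (t : R) : 0 < t ->
  (P [set w | exists q, (B + t < exc (c q) w - kap * exc (c q0) w)%R]
    <= (expR (- (2 * n%:R * t ^+ 2 / (1 + kap) ^+ 2)))%:E)%E.
Proof.
move=> t0; set A := [set w | _].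
have kap1 : 0 < 1 + kap by rewrite ltr_pwDl.
have mA : measurable A.
  rewrite [A](_ : _ = \bigcup_(q in [set: Q])
      ([set: T] `&` (fun w => exc (c q) w - kap * exc (c q0) w) @^-1` `]B + t, +oo[%classic)).
    apply: fin_bigcup_measurable; first exact: finite_finset.
    move=> q _; have : measurable_fun [set: T] (fun w => exc (c q) w - kap * exc (c q0) w).
      apply: measurable_funB; first exact: measurable_excess.
      apply: measurable_funM; [exact: measurable_cst | exact: measurable_excess].
    by apply => //; exact: measurable_itv.
  apply/seteqP; split => [w [q Aq]|w [q _ []]] /=.
    by exists q => //; split => //=; rewrite in_itv /= Aq.
  by move=> _; rewrite in_itv /= andbT => Aq; exists q.
have tail t' : 0 < t' < t ->
    (P A <= (expR (- (2 * n%:R * t' ^+ 2 / (1 + kap) ^+ 2)))%:E)%E.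
  move=> /andP[t'0 t't]; pose eta := (t - t') / (2 * (1 + kap)).
  have eta0 : 0 < eta by rewrite divr_gt0 ?subr_gt0 ?mulr_gt0.
  have [V [p [x [S [pP Sn SE close]]]]] := finite_model sigma Hindep Hcopies n0 c eta0.
  have [F [DF EF bF]] := model_deviation x pP.
  pose Qp s := B + t' <= F s.
  have := mcdiarmid pP n0 (divr_gt0 kap1 n0R) (ltW t'0) bF (Q := Qp).
  have -> : 2 * t' ^+ 2 / (n%:R * ((1 + kap) / n%:R) ^+ 2) =
      2 * n%:R * t' ^+ 2 / (1 + kap) ^+ 2.
    by field; rewrite !lt0r_neq0.
  have QpE s : Qp s -> Esample p n F + t' <= F s.
    by apply: le_trans; rewrite lerD2r.
  move=> /(_ QpE); have [mQ [iQ <-]] := SE (fun s => (Qp s)%:R).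
  pose A' := [set w | Qp (S w)].
  have A'E : (fun w => (Qp (S w))%:R : R) = \1_A'.
    apply/funext => w; rewrite indicE; congr (_%:R).
    by case: (boolP (Qp (S w))) => Qw; [rewrite mem_set|rewrite memNset //; exact/negP].
  have mA' : measurable A'.
    rewrite [A'](_ : _ = [set: T] `&` (fun w => (Qp (S w))%:R : R) @^-1` [set 1]).
      by apply: mQ => //; exact: measurable_set1.
    apply/seteqP; split => w /=; rewrite /A' /=; first by move=> ->.
    by case: (Qp _) => //= -[_ /eqP]; rewrite eq_sym oner_eq0.
  rewrite A'E /Rintegral integral_indic // setIT -lee_fin fineK ?fin_num_measure //.
  apply: le_trans; apply: le_measure; rewrite ?inE // => w [q Aq].
  rewrite /A' /= /Qp; apply: le_trans (DF q _).
  have := close w q; have := close w q0; rewrite -/exc !ler_norml.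
  set a := dev _ _ _; set b := dev _ _ _ => /andP[a1 a2] /andP[b1 b2].
  have ek : t - t' = 2 * eta + kap * (2 * eta) by rewrite /eta; field; rewrite lt0r_neq0.
  have := ler_wpM2l kap0 a2; move: Aq; rewrite -/exc; lra.
have [PA0|PA1] := leP (P A) (expR (- (2 * n%:R * t ^+ 2 / (1 + kap) ^+ 2)))%:E => //.
exfalso.
pose f (s : R) := expR (- (2 * n%:R * s ^+ 2 / (1 + kap) ^+ 2)).
have cf : f s @[s --> t^'-] --> f t.
  apply: cvg_at_left_filter; rewrite /f.
  apply: continuous_comp; last exact: continuous_expR.
  apply: cvgN; apply: cvgM; last exact: cvg_cst.
  by apply: cvgM; [exact: cvg_cst | exact: exprn_continuous].
have PAf : P A \is a fin_num by exact: fin_num_measure.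
have : fine (P A) <= f t.
  have : \forall s \near t^'-, fine (P A) <= f s.
    near=> s; rewrite -lee_fin fineK //; apply: tail; apply/andP; split.
      by near: s; exact: nbhs_left_gt.
    by near: s; exact: nbhs_left_lt.
  by move=> H1; apply: cvgr_to_ge cf H1.
rewrite -lee_fin fineK // => /(lt_le_trans PA1).
by rewrite ltxx.
Unshelve. all: by end_near. Qed.

Lemma excess_mean :
  \int[P]_w (\big[Num.max/exc (c q0) w]_q exc (c q) w - kap * exc (c q0) w) <= B.
Proof.
have kap1 : 0 < 1 + kap by rewrite ltr_pwDl.
apply/ler_addgt0Pr => e e0.
pose eta := e / (2 * (1 + kap)).
have eta0 : 0 < eta by rewrite divr_gt0 ?mulr_gt0.
have [V [p [x [S [pP Sn SE close]]]]] := finite_model sigma Hindep Hcopies n0 c eta0.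
have [F [DF EF bF]] := model_deviation x pP.
have [mF [iF FE]] := SE F.
have ek : e = 2 * eta + kap * (2 * eta) by rewrite /eta; field; rewrite lt0r_neq0.
have key w : \big[Num.max/exc (c q0) w]_q exc (c q) w - kap * exc (c q0) w <= F (S w) + e.
  have close' q : exc (c q) w - kap * exc (c q0) w <= F (S w) + e.
    have := DF q (S w); have := close w q; have := close w q0; rewrite -/exc !ler_norml.
    set a := dev _ _ _; set b := dev _ _ _ => /andP[a1 a2] /andP[b1 b2].
    have := ler_wpM2l kap0 a2; lra.
  by rewrite lerBlDr; apply: bigmax_le => [|q _]; rewrite -lerBlDr; exact: close'.
apply: (@le_trans _ _ (\int[P]_w (F (S w) + e))); last first.
  rewrite RintegralD //; last exact: integrable_cst.
  by rewrite FE Rintegral_cst_prob lerD2r.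
apply: le_Rintegral => //.
- have mm := measurable_bigmax (index_enum Q) (measurable_excess (c q0))
    (fun q => measurable_excess (c q)).
  have m0 : measurable_fun [set: T] (fun w => kap * exc (c q0) w).
    by apply: measurable_funM; [exact: measurable_cst | exact: measurable_excess].
  apply: (@bounded_integrable _ _ _ P _ (2 + kap * 2)); first exact: measurable_funB.
  move=> w; apply: le_trans (ler_normB _ _) _; apply: lerD.
    elim/big_ind: _ => [|a b a2 b2|q _]; try exact: excess_norm.
    by rewrite /Num.max; case: ifP.
  by rewrite normrM (ger0_norm kap0) ler_wpM2l // excess_norm.
- have := integrableD measurableT iF (integrable_cst P e).
  by apply: eq_integrable.
Qed.

End Family.

Hypothesis Hsep : separable H.

Lemma excess_close (c c' : 'I_k -> H) (e : R) :
  (forall x, `|fit sigma c x - fit sigma c' x| <= e) ->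
  forall w, exc c w - exc c' w <= 2 * e.
Proof.
move=> cc' w; rewrite (_ : exc c w - exc c' w =
  n%:R^-1 * (\sum_(i < n) (fit sigma c (Xs i w) - fit sigma c' (Xs i w)))
  - (\int[distribution P0 X]_x fit sigma c x
     - \int[distribution P0 X]_x fit sigma c' x)); last first.
  by rewrite sumrB /exc /excess; ring.
have h1 : n%:R^-1 * (\sum_(i < n) (fit sigma c (Xs i w) - fit sigma c' (Xs i w))) <= e.
  rewrite ler_pdivrMl //; apply: (@le_trans _ _ (\sum_(i < n) e)).
    by apply: ler_sum => i _; exact: le_trans (ler_norm _) (cc' _).
  by rewrite sumr_const card_ord mulr_natl.
have := @Rintegral_close _ _ _ (distribution P0 X) (fit sigma c) (fit sigma c')
  1 1 e (measurable_fit sigma c) (measurable_fit sigma c')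
  (fit_norm sigma c) (fit_norm sigma c') cc'.
by rewrite ler_norml => /andP[h2 _]; lra.
Qed.

(** The finite families exhaust a countable dense family of codebooks, and the
    bounds do not depend on their size. *)
Lemma uniform_deviation (cstar : 'I_k -> H) (kap t : R) : 0 <= kap -> 0 < t ->
  with_prob_ge P (1 - expR (- (2 * n%:R * t ^+ 2 / (1 + kap) ^+ 2)))
    [set w | forall c, exc c w - kap * exc cstar w <= B + t].
Proof.
move=> kap0 t0; have [cc [cc0 dense]] := fit_dense_sequence cstar s0 Hsep.
set e := expR _.
pose U (N : nat) := [set w | exists q : 'I_N.+1, B + t < exc (cc q) w - kap * exc cstar w].
have UE N : U N = \bigcup_(m in `I_N.+1)
    ([set: T] `&` (fun w => exc (cc m) w - kap * exc cstar w) @^-1` `]B + t, +oo[%classic).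
  apply/seteqP; split => [w [q Aq]|w [m mN []]] /=.
    by exists (q : nat) => //=; split => //; rewrite in_itv /= Aq.
  by move=> _; rewrite in_itv /= andbT => Aq; exists (Ordinal mN).
have mU N : measurable (U N).
  rewrite UE; apply: bigcup_measurable => m _.
  suff mf : measurable_fun [set: T] (fun w => exc (cc m) w - kap * exc cstar w).
    by apply: mf => //; exact: measurable_itv.
  apply: measurable_funB; first exact: measurable_excess.
  by apply: measurable_funM; [exact: measurable_cst | exact: measurable_excess].
have mUU : measurable (\bigcup_N U N) by exact: bigcupT_measurable.
exists (~` \bigcup_N U N); split; first exact: measurableC.
- move=> w /= wU c; apply/ler_addgt0Pr => eps eps0.
  have e20 : 0 < eps / 2 by rewrite divr_gt0.
  have [m cm] := dense c _ e20.
  have wm : exc (cc m) w - kap * exc cstar w <= B + t.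
    rewrite leNgt; apply/negP => Bm; apply: wU; exists m => //.
    by exists ord_max.
  by have := excess_close cm w; lra.
- have PU : (P (\bigcup_N U N) <= e%:E)%E.
    have ndU : {homo U : i j / (i <= j)%N >-> (i <= j)%O}.
      move=> i j ij; apply/subsetPset => w [q Aq].
      by exists (widen_ord (ij : (i.+1 <= j.+1)%N) q).
    apply: (cvge_to_le (nondecreasing_cvg_mu mU mUU ndU)).
    apply: nearW => N /=; rewrite /U.
    have := excess_tail (fun q : 'I_N.+1 => cc q) ord0 kap0 t0.
    by rewrite /= cc0.
  rewrite [P _](probability_setC P mUU) EFinB leeB //.
Qed.

(** The suprema over the initial segments of the dense sequence increase to the
    supremum over all codebooks, and dominated convergence applies. *)
Lemma mean_deviation (cstar : 'I_k -> H) : exists W : T -> R,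
  [/\ P.-integrable [set: T] (EFin \o W),
      forall c w, exc c w - exc cstar w <= W w
    & \int[P]_w W w <= B].
Proof.
have [cc [cc0 dense]] := fit_dense_sequence cstar s0 Hsep.
pose M N w := \big[Num.max/exc cstar w]_(q < N.+1) exc (cc q) w.
have M2 N w : `|M N w| <= 2.
  rewrite /M; elim/big_ind: _ => [|a b a2 b2|q _]; try exact: excess_norm.
  by rewrite /Num.max; case: ifP.
have Mnd w : nondecreasing_seq (M ^~ w).
  move=> i j ij; rewrite /M; apply: bigmax_le => [|q _]; first exact: bigmax_ge_id.
  exact: (le_bigmax _ (fun q : 'I_j.+1 => exc (cc q) w) (widen_ord (ij : (i.+1 <= j.+1)%N) q)).
have Mub w : has_ubound (range (M ^~ w)).
  by exists 2 => _ [N _ <-]; exact: le_trans (ler_norm _) (M2 N w).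
pose S w := sup (range (M ^~ w)).
have McvgS w : M ^~ w @ \oo --> S w by exact: nondecreasing_cvgn.
have MS N w : M N w <= S w by apply: ub_le_sup => //; exists N.
have mM N : measurable_fun [set: T] (fun w => M N w - 1 * exc cstar w).
  apply: measurable_funB; first by apply: measurable_bigmax => *; exact: measurable_excess.
  by apply: measurable_funM; [exact: measurable_cst | exact: measurable_excess].
pose W w := S w - 1 * exc cstar w.
have cvgW w : (fun N => M N w - 1 * exc cstar w) @ \oo --> W w.
  by apply: cvgB => //; exact: cvg_cst.
have cvgWE w : (fun N => (M N w - 1 * exc cstar w)%:E) @ \oo --> (W w)%:E.
  by apply/fine_cvgP; split; [exact: nearW | exact: cvgW].
have mW : measurable_fun [set: T] W.
  by apply: (measurable_fun_cvg mM) => w _; exact: cvgW.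
have W4 N w : `|M N w - 1 * exc cstar w| <= 4.
  rewrite (_ : 4 = 2 + 2) //; last by ring.
  apply: le_trans (ler_normB _ _) _; apply: lerD => //; rewrite mul1r.
  exact: excess_norm.
have [iW _ lim] := @dominated_convergence _ T R P setT measurableT
  (fun N w => (M N w - 1 * exc cstar w)%:E) (EFin \o W) (EFin \o (fun=> 4))
  (fun N => (measurable_EFinP _ _).2 (mM N)) ((measurable_EFinP _ _).2 mW)
  (aeW _ (fun w _ => cvgWE w)) (integrable_cst P 4)
  (aeW _ (fun w N _ => W4 N w)).
exists W; split => //.
- move=> c w; apply/ler_addgt0Pr => e e0.
  have e20 : 0 < e / 2 by rewrite divr_gt0.
  have [m cm] := dense c _ e20.
  have := excess_close cm w.
  have h : exc (cc m) w <= S w.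
    apply: le_trans (MS m w).
    exact: (le_bigmax _ (fun q : 'I_m.+1 => exc (cc q) w) ord_max).
  rewrite /W mul1r; lra.
- rewrite -lee_fin /Rintegral fineK; last exact: integrable_fin_num.
  apply: (cvge_to_le lim); apply: nearW => N.
  have := excess_mean (fun q : 'I_N.+1 => cc q) ord0 ler01.
  rewrite -lee_fin /Rintegral fineK /= cc0 //; last first.
    apply: integrable_fin_num => //.
    by apply: (@bounded_integrable _ _ _ P _ 4); [exact: mM | exact: W4].
Qed.

End Deviations.

(** * The risks *)

Lemma risk2E (R : realType) (H : completeNormedModType R)
    (mu : probability (borel H) R) (sigma : R) (k : nat) (c : 'I_k -> H) :
  (0 < k)%N ->
  risk2 mu sigma c = 2 * sigma ^+ 2 * (1 - \int[mu]_x fit sigma c x).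
Proof.
move=> k0; rewrite /risk2; congr (_ * _).
rewrite (_ : robust_loss sigma c = fun x => 1 - fit sigma c x); last first.
  by apply/funext => x; exact: robust_lossE.
rewrite RintegralB //; last 2 first.
- exact: integrable_cst.
- exact: (bounded_integrable mu (measurable_fit sigma c) (fit_norm sigma c)).
by rewrite Rintegral_cst_prob.
Qed.

Lemma emp_risk2E (R : realType) (H : completeNormedModType R) (sigma : R)
    (n : nat) (xs : 'I_n -> H) (k : nat) (c : 'I_k -> H) : (0 < k)%N -> (0 < n)%N ->
  emp_risk2 sigma xs c =
  2 * sigma ^+ 2 * (1 - n%:R^-1 * \sum_(i < n) fit sigma c (xs i)).
Proof.
move=> k0 n0; rewrite /emp_risk2; congr (_ * _).
rewrite (eq_bigr (fun i => 1 - fit sigma c (xs i))); last first.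
  by move=> i _; exact: robust_lossE.
by rewrite sumrB sumr_const card_ord mulrBr mulVf // pnatr_eq0 -lt0n.
Qed.

(** The infimum of the risk need not be reached, and the event provided by a
    comparison with a near minimizer depends on that minimizer; an oracle
    inequality with the infimum itself holds on the upper limit of these
    events. *)
Lemma with_prob_ge_limsup (R : realType) (d : measure_display)
    (T : measurableType d) (P : probability T R) (p : R) (E : nat -> set T) :
  (forall m, with_prob_ge P p (E m)) ->
  with_prob_ge P p (\bigcap_N \bigcup_(m in [set m | (N <= m)%N]) E m).
Proof.
move=> /choice[A AE]; pose U N := \bigcup_(m in [set m | (N <= m)%N]) A m.
have mU N : measurable (U N).
  by apply: bigcup_measurable => m _; case: (AE m).
have mUU : measurable (\bigcap_N U N) by exact: bigcapT_measurable.
exists (\bigcap_N U N); split => //.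
  move=> w wU N _; have [m Nm Am] := wU N I; exists m => //.
  by case: (AE m) => _ /(_ w Am).
have niU : {homo U : i j / (i <= j)%N >-> (j <= i)%O}.
  move=> i j ij; apply/subsetPset => w [m jm Am]; exists m => //.
  exact: leq_trans ij jm.
have U0 : (P (U 0%N) < +oo)%E.
  by apply: le_lt_trans (probability_le1 P (mU 0%N)) _; rewrite ltry.
apply: (cvge_to_ge (nonincreasing_cvg_mu U0 mU mUU niU)).
apply: nearW => N; have [mA _ pA] := AE N; apply: le_trans pA _.
by apply: le_measure; [rewrite inE | rewrite inE; exact: mU | move=> w Aw; exists N => /=].
Qed.

Lemma with_prob_geS (R : realType) (d : measure_display)
    (T : measurableType d) (P : probability T R) (p : R) (E F : set T) :
  E `<=` F -> with_prob_ge P p E -> with_prob_ge P p F.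
Proof. by move=> EF [A [mA AE pA]]; exists A; split => // w /AE/EF. Qed.

Theorem proposition19 (R : realType) (H : completeNormedModType R)
    (dotp : {dot H for @idfun R}) (Hhilbert : induces_norm dotp)
    (Hsep : separable H)
    (d0 : measure_display) (T0 : measurableType d0) (P0 : probability T0 R)
    (X : {RV P0 >-> borel H})
    (n k : nat) (sigma : R)
    (Hsigma : 0 < sigma) (Hk : (2 <= k)%N) (Hn : (2 * k <= n)%N)
    (d : measure_display) (T : measurableType d) (P : probability T R)
    (Xs : 'I_n -> {RV P >-> borel H})
    (Hindep : mutually_independent Xs)
    (Hcopies : forall i, identically_distributed (Xs i) X) :
  let sample (w : T) : 'I_n -> H := fun i => Xs i w in
  let R2 (c : 'I_k -> H) : R := risk2 (distribution P0 X) sigma c in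
  let R2bar (w : T) (c : 'I_k -> H) : R := emp_risk2 sigma (sample w) c in
  [/\ forall delta : R, 0 < delta < 1 ->
        with_prob_ge P (1 - delta) [set w | forall c : 'I_k -> H,
          R2 c <= R2bar w c + 2 * sigma ^+ 2 *
            (chaining_bound R n k + Num.sqrt (ln delta^-1 / (2 * n%:R)))],
      forall (cstar : 'I_k -> H) (delta : R), 0 < delta < 1 ->
        with_prob_ge P (1 - delta) [set w | forall c : 'I_k -> H,
          R2 c - R2 cstar <= R2bar w c - R2bar w cstar + 2 * sigma ^+ 2 *
            (chaining_bound R n k + Num.sqrt (2 * ln delta^-1 / n%:R))]
    & forall (eps : R) (chat : ('I_n -> H) -> 'I_k -> H), 0 <= eps ->
        (forall w, R2bar w (chat (sample w)) <= inf (range (R2bar w)) + eps) ->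
        (forall delta : R, 0 < delta < 1 ->
           with_prob_ge P (1 - delta) [set w |
             R2 (chat (sample w)) <= inf (range R2) + 2 * sigma ^+ 2 *
               (chaining_bound R n k + Num.sqrt (2 * ln delta^-1 / n%:R))
               + eps])
        /\
        (measurable_fun [set: T] (fun w => R2 (chat (sample w))) ->
         ('E_P[fun w => R2 (chat (sample w))] <=
           (inf (range R2) + 2 * sigma ^+ 2 * chaining_bound R n k
             + eps)%:E)%E)].
Proof.
move=> sample R2 R2bar.
have k0 : (0 < k)%N by exact: leq_trans Hk.
have n0 : (0 < n)%N by apply: leq_trans Hn; rewrite muln_gt0.
have n0R : 0 < n%:R :> R by rewrite ltr0n.
set B := chaining_bound R n k.
pose a := 2 * sigma ^+ 2; have a0 : 0 < a by rewrite mulr_gt0 // exprn_gt0.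
pose exc : ('I_k -> H) -> T -> R := excess X sigma Xs.
have R2E w c : R2 c - R2bar w c = a * exc c w.
  by rewrite /R2 /R2bar risk2E // emp_risk2E // /a /exc /excess; ring.
have R2_01 c : 0 <= R2 c <= a.
  have fit_int : 0 <= \int[distribution P0 X]_x fit sigma c x <= 1.
    have mf := measurable_fit sigma c; have f1 := fit_norm sigma c.
    apply/andP; split.
      rewrite -[leLHS](Rintegral_cst_prob (distribution P0 X)).
      apply: (@le_Rintegral_bounded _ _ _ _ (fun=> 0) _ `|0 : R| 1) => // x.
      by case/andP: (fit01 sigma c x).
    rewrite -[leRHS](Rintegral_cst_prob (distribution P0 X)).
    apply: (@le_Rintegral_bounded _ _ _ _ _ (fun=> 1) 1 `|1 : R|) => // x.
    by case/andP: (fit01 sigma c x).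
  have /andP[f0 f1] := fit_int.
  rewrite /R2 risk2E // mulr_ge0 ?(ltW a0) ?subr_ge0 //=.
  by rewrite -[leRHS]mulr1 ler_wpM2l ?(ltW a0) // lerBlDr lerDl.
have R2bar_ge0 w c : 0 <= R2bar w c.
  rewrite /R2bar emp_risk2E // mulr_ge0 ?(ltW a0) // subr_ge0.
  rewrite ler_pdivrMl // mulr1.
  apply: (@le_trans _ _ (\sum_(i < n) 1)); last by rewrite sumr_const card_ord.
  by apply: ler_sum => i _; case/andP: (fit01 sigma c (sample w i)).
have dev_above (cstar : 'I_k -> H) (kap t : R) : 0 <= kap -> 0 < t ->
    with_prob_ge P (1 - expR (- (2 * n%:R * t ^+ 2 / (1 + kap) ^+ 2)))
      [set w | forall c, exc c w - kap * exc cstar w <= B + t].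
  exact: uniform_deviation.
have mean_above (cstar : 'I_k -> H) : exists W : T -> R,
    [/\ P.-integrable [set: T] (EFin \o W),
        forall c w, exc c w - exc cstar w <= W w & \int[P]_w W w <= B].
  exact: mean_deviation.
have aE : 2 * sigma ^+ 2 = a by [].
rewrite aE; clearbody R2 R2bar exc a B.
have ln_pos (delta : R) : 0 < delta < 1 -> 0 < ln delta^-1.
  by move=> /andP[dl0 dl1]; rewrite ln_gt0 // invf_gt1.
have expE (delta : R) : 0 < delta < 1 -> expR (- ln delta^-1) = delta.
  by move=> /andP[dl0 dl1]; rewrite lnV ?posrE // opprK lnK.
(* the second statement also yields the third one *)
have part2 (cstar : 'I_k -> H) (delta : R) : 0 < delta < 1 ->
    with_prob_ge P (1 - delta) [set w | forall c : 'I_k -> H,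
      R2 c - R2 cstar <= R2bar w c - R2bar w cstar +
        a * (B + Num.sqrt (2 * ln delta^-1 / n%:R))].
  move=> dl01; have l0 := ln_pos _ dl01; set t := Num.sqrt _.
  have x0 : 0 < 2 * ln delta^-1 / n%:R by rewrite divr_gt0 ?mulr_gt0.
  have t0 : 0 < t by rewrite sqrtr_gt0.
  have := dev_above cstar 1 t ler01 t0; rewrite sqr_sqrtr ?(ltW x0) //.
  rewrite (_ : 2 * n%:R * _ / _ = ln delta^-1); last by field; rewrite lt0r_neq0.
  rewrite expE //; apply: with_prob_geS => w /= dev c.
  have := R2E w c; have := R2E w cstar.
  have := ler_wpM2l (ltW a0) (dev c); rewrite mul1r mulrBr; lra.
split=> //.
  move=> delta dl01; have l0 := ln_pos _ dl01; set t := Num.sqrt _.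
  have x0 : 0 < ln delta^-1 / (2 * n%:R) by rewrite divr_gt0 ?mulr_gt0.
  have t0 : 0 < t by rewrite sqrtr_gt0.
  have := dev_above (fun=> 0) 0 t (lexx 0) t0; rewrite sqr_sqrtr ?(ltW x0) //.
  rewrite (_ : 2 * n%:R * _ / _ = ln delta^-1); last by field; rewrite lt0r_neq0.
  rewrite expE //; apply: with_prob_geS => w /= dev c.
  have := R2E w c.
  have := ler_wpM2l (ltW a0) (dev c); rewrite mul0r subr0; lra.
move=> eps chat eps0 chatE.
have inf_bar w c : inf (range (R2bar w)) <= R2bar w c.
  by apply: ge_inf; [exists 0 => _ [c' _ <-]; exact: R2bar_ge0 | exists c].
have near_inf (e : R) : 0 < e -> exists c, R2 c < inf (range R2) + e.
  move=> e0; have hinf : has_inf (range R2).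
    by split; [exists (R2 (fun=> 0)), (fun=> 0) | exists 0 => _ [c _ <-]; case/andP: (R2_01 c)].
  by have [_ [c _ <-] ce] := inf_adherent e0 hinf; exists c.
split=> [delta dl01|mchat].
  have /choice[cs csE] (m : nat) : exists c, R2 c < inf (range R2) + m.+1%:R^-1.
    by apply: near_inf; rewrite invr_gt0.
  apply: with_prob_geS (with_prob_ge_limsup (fun m => part2 (cs m) delta dl01)).
  move=> w /= wE; apply/ler_addgt0Pr => e e0.
  have [m Nm Em] := wE (Num.truncn e^-1) Logic.I.
  have me : m.+1%:R^-1 <= e.
    rewrite -[leRHS]invrK lef_pV2 ?posrE ?invr_gt0 //.
    apply: (@le_trans _ _ (Num.truncn e^-1).+1%:R); last by rewrite ler_nat.
    by apply: ltW; exact: truncnS_gt.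
  have h1 := Em (chat (sample w)); have h2 := chatE w; have h3 := inf_bar w (cs m).
  have h4 : R2 (cs m) <= inf (range R2) + e by exact: le_trans (ltW (csE m)) (lerD (lexx _) me).
  lra.
have iR2 : P.-integrable [set: T] (EFin \o (fun w => R2 (chat (sample w)))).
  apply: (@bounded_integrable _ _ _ P _ a) => // w.
  by have /andP[r0 r1] := R2_01 (chat (sample w)); rewrite ger0_norm.
rewrite unlock -[leLHS]fineK; last exact: integrable_fin_num.
rewrite lee_fin; apply/ler_addgt0Pr => e e0.
have [cs csE] := near_inf e e0.
have [W [iW WE WB]] := mean_above cs.
apply: (@le_trans _ _ (\int[P]_w ((inf (range R2) + e + eps) + a * W w))).
  apply: le_Rintegral => //.
    have iaW : P.-integrable [set: T] (EFin \o (fun w => a * W w)).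
      exact: (integrableZl measurableT a iW).
    exact: (integrableD measurableT (integrable_cst P _) iaW).
  move=> w _; have := R2E w cs; have := R2E w (chat (sample w)).
  have := chatE w; have := inf_bar w cs.
  have := ler_wpM2l (ltW a0) (WE (chat (sample w)) w); rewrite mulrBr; lra.
have iaW : P.-integrable [set: T] (EFin \o (fun w => a * W w)).
  exact: (integrableZl measurableT a iW).
rewrite RintegralD //; last exact: integrable_cst.
rewrite Rintegral_cst_prob RintegralZl //.
have := ler_wpM2l (ltW a0) WB; lra.
Qed.
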